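(* Let $A$ be a weighted $\mathbb{N}$-filtered solvable polynomial algebra with respect to a positive-degree function $d(~)$, let $L_0=\oplus_{i=1}^mAe_i$ be a filtered free $A$-module with $d_{\rm fil}(e_i)=b_i$, let $N$ be a submodule of $L_0$, and let $M=L_0/N$ have the filtration $FM=\{F_qM=(F_qL_0+N)/N\}_{q\in\mathbb{N}}$. Let $$\mathcal{L}_\bullet\quad\cdots\xrightarrow{\varphi_{i+1}}L_i\xrightarrow{\varphi_i}\cdots\xrightarrow{\varphi_2}L_1\xrightarrow{\varphi_1}L_0\xrightarrow{\varphi_0}M\to0$$ be a minimal filtered free resolution of $M$. Then: (i) The associated sequence of graded $G(A)$-modules and graded $G(A)$-module homomorphisms $$\cdots\xrightarrow{G(\varphi_{i+1})}G(L_i)\xrightarrow{G(\varphi_i)}\cdots\xrightarrow{G(\varphi_2)}G(L_1)\xrightarrow{G(\varphi_1)}G(L_0)\xrightarrow{G(\varphi_0)}G(M)\to0$$ is a minimal graded free resolution of the finitely generated graded $G(A)$-module $G(M)$. (ii) The associated sequence of graded $\widetilde{A}$-modules and graded $\widetilde{A}$-module homomorphisms $$\cdots\xrightarrow{\widetilde{\varphi}_{i+1}}\widetilde{L}_i\xrightarrow{\widetilde{\varphi}_i}\cdots\xrightarrow{\widetilde{\varphi}_2}\widetilde{L}_1\xrightarrow{\widetilde{\varphi}_1}\widetilde{L}_0\xrightarrow{\widetilde{\varphi}_0}\widetilde{M}\to0$$ is a minimal graded free resolution of the finitely generated graded $\widetilde{A}$-module $\widetilde{M}$. (iii) $\mathcal{L}_\bullet$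 is uniquely determined by $M$ in the following sense: if $$\mathcal{L}'_\bullet\quad\cdots\xrightarrow{\varphi'_{i+1}}L'_i\xrightarrow{\varphi'_i}\cdots\xrightarrow{\varphi'_2}L'_1\xrightarrow{\varphi'_1}L_0\xrightarrow{\varphi_0}M\to0$$ is another minimal filtered free resolution of $M$, then, with $L'_0=L_0$ and $\chi_0=\mathrm{id}_{L_0}$, for each $i\ge1$ there is a strict filtered $A$-module isomorphism $\chi_i:L_i\to L_i'$ such that $\chi_{i-1}\varphi_i=\varphi_i'\chi_i$; thereby $\{\chi_i\mid i\ge1\}$ gives rise to a strict filtered isomorphism of chain complexes of filtered modules $\mathcal{L}_\bullet\cong\mathcal{L}'_\bullet$.
   Context: $K$ is a field, $\mathbb{N}$ the nonnegative integers, modules are left unitary modules. Finite sets displayed as $\{v_1,\ldots,v_m\}$ are treated as indexed families. Solvable polynomial algebra: a $K$-algebra $A=K[a_1,\ldots,a_n]$ with minimal generating set $\{a_1,\ldots,a_n\}$ having $K$-basis $\mathscr{B}=\{a^\alpha=a_1^{\alpha_1}\cdots a_n^{\alpha_n}\mid\alpha\in\mathbb{N}^n\}$ and a total ordering $\prec$ on $\mathscr{B}$ such that, writing $\mathbf{LM}(f)$ for the $\prec$-largest monomial occurring in $f\neq0$: (1) $\prec$ is a well-ordering; (2) $a^\alpha\prec a^\beta$ and $\mathbf{LM}(a^\gamma a^\alpha a^\eta),\mathbf{LM}(a^\gamma a^\beta a^\eta)\notin K$ imply $\mathbf{LM}(a^\gamma a^\alpha a^\eta)\prec\mathbf{LM}(a^\gamma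 a^\beta a^\eta)$; (3) if $a^\beta\ne a^\gamma$ and $a^\gamma=\mathbf{LM}(a^\alpha a^\beta a^\eta)$ then $a^\beta\prec a^\gamma$; and $a^\alpha a^\beta=\lambda_{\alpha,\beta}a^{\alpha+\beta}+f_{\alpha,\beta}$ with $\lambda_{\alpha,\beta}\in K\setminus\{0\}$ and $f_{\alpha,\beta}=0$ or $\mathbf{LM}(f_{\alpha,\beta})\prec a^{\alpha+\beta}$. A positive-degree function $d(~)$ is given by positive integers $d(a_i)=m_i$: $d(a^\alpha)=\sum m_i\alpha_i$, and $d(f)$ is the maximum of $d(a^\alpha)$ over monomials occurring in $f\ne0$. $A$ is a weighted $\mathbb{N}$-filtered solvable polynomial algebra w.r.t. $d$ if $F_pA=K\text{-span}\{a^\alpha\mid d(a^\alpha)\le p\}$ satisfies $F_pAF_qA\subseteq F_{p+q}A$ for all $p,q\in\mathbb{N}$. A filtered $A$-module $M$ has $K$-subspaces $F_qM$ ($q\in\mathbb{N}$) with $F_qM\subseteq F_{q+1}M$, $\cup_qF_qM=M$, $F_pAF_qM\subseteq F_{p+q}M$; put $F_{-1}M=0$, $F_{-1}A=0$. For $0\ne\xi\in M$, $d_{\rm fil}(\xi)=q$ means $\xi\in F_qM\setminus F_{q-1}M$. A submodule $N\subseteq M$ has induced filtration $F_qN=N\cap F_qM$. A filtered free module $L=\oplus_{i=1}^sAe_i$ with $d_{\rm fil}(e_i)=b_i\in\mathbb{N}$ has $F_qL=K\text{-span}\{a^\alpha e_i\mid d(a^\alpha)+b_i\le q\}$. Associated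 graded: $G(A)=\oplus_pF_pA/F_{p-1}A$, $G(M)=\oplus_qF_qM/F_{q-1}M$. Rees: $\widetilde{A}=\oplus_pF_pA$, $\widetilde{M}=\oplus_qF_qM$ (external direct sums, with $F_pA$, $F_qM$ as homogeneous parts of degree $p$, $q$). All are $\mathbb{N}$-graded, with degree-0 part of $G(A)$ and $\widetilde{A}$ equal to $K$. A filtered homomorphism $\varphi:M\to M'$ (i.e. $\varphi(F_qM)\subseteq F_qM'$ for all $q$) induces graded homomorphisms $G(\varphi):G(M)\to G(M')$ and $\widetilde{\varphi}:\widetilde{M}\to\widetilde{M'}$. $\varphi$ is strict filtered if $\varphi(F_qM)=\varphi(M)\cap F_qM'$ for all $q$; a strict filtered isomorphism is an $A$-isomorphism with $\varphi(F_qM)=F_qM'$ for all $q$. F-basis: a finite set of nonzero elements $v_1,\ldots,v_m\in M$ for which there are $n_1,\ldots,n_m\in\mathbb{N}$ with $F_qM=\sum_i\left(\sum_{p_i+n_i\le q}F_{p_i}A\right)v_i$ for all $q$. It is minimal if no proper subset is an F-basis. A (minimal) standard basis of a submodule $N\subseteq M$ is a (minimal) F-basis of $N$ for the induced filtration. Minimal filtered free resolution of $M=L_0/N$: an exact sequence of filtered homomorphisms $\cdots\to L_i\xrightarrow{\varphi_i}\cdots\to L_1\xrightarrow{\varphi_1}L_0\xrightarrow{\varphi_0}M\to0$ such that (1) $\varphi_0$ is the canonical epimorphism and the images $\overline{e}_1,\ldots,\overline{e}_m$ of the basis of $L_0$ form a minimal F-basis of $M$ with respect to $FM$; (2) for $i\ge1$,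 $L_i$ is a filtered free $A$-module with finite basis $\mathscr{E}_i$, $\varphi_i$ is a strict filtered homomorphism, and $\varphi_i(\mathscr{E}_i)$ is a minimal standard basis of $\mathrm{Ker}\,\varphi_{i-1}$ for the filtration induced by $FL_{i-1}$. A minimal graded free resolution (over $G(A)$ or $\widetilde{A}$) is a graded free resolution in which a homogeneous basis of each free module is mapped to a minimal homogeneous generating set of its image. *)

(* Defs.v *)
From HB Require Import structures.
From mathcomp Require Import all_boot all_order all_algebra.
From mathcomp Require Import boolp classical_sets.

Set Implicit Arguments.
Unset Strict Implicit.
Unset Printing Implicit Defensive.

Import GRing.Theory.
Local Open Scope ring_scope.
Local Open Scope quotient_scope.
Local Open Scope classical_set_scope.

Record dsum (P : nat -> zmodType) := Dsum {
  dsum_fun :> forall q, P q;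
  dsum_fin : exists n, forall q, (n <= q)%N -> dsum_fun q = 0 }.

Definition dsum_hom (P : nat -> zmodType) (q : nat) : set (dsum P) :=
  [set x | forall j, j <> q -> x j = 0].

Section DsumTheory.
Variable P : nat -> zmodType.
Implicit Types x y z : dsum P.

Lemma dsumP x y : (forall q, x q = y q) -> x = y.
Proof.
case: x y => f hf [g hg] /= fg.
have e : f = g by apply: functional_extensionality_dep.
by subst g; congr Dsum; apply: Prop_irrelevance.
Qed.

HB.instance Definition _ := gen_eqMixin (dsum P).
HB.instance Definition _ := gen_choiceMixin (dsum P).

Fact dsum0_fin : exists n, forall q, (n <= q)%N -> (0 : P q) = 0.
Proof. by exists 0%N. Qed.
Definition dsum0 : dsum P := Dsum dsum0_fin.

Fact dsumN_fin x : exists n, forall q, (n <= q)%N -> - x q = 0.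
Proof. by have [n hn] := dsum_fin x; exists n => q /hn ->; rewrite oppr0. Qed.
Definition dsumN x : dsum P := Dsum (dsumN_fin x).

Fact dsumD_fin x y : exists n, forall q, (n <= q)%N -> x q + y q = 0.
Proof.
have [n hn] := dsum_fin x; have [m hm] := dsum_fin y.
exists (n + m)%N => q le_q.
by rewrite hn ?hm ?addr0 // (leq_trans _ le_q) ?leq_addl ?leq_addr.
Qed.
Definition dsumD x y : dsum P := Dsum (dsumD_fin x y).

Fact dsum_addA : associative dsumD.
Proof. by move=> x y z; apply: dsumP => q; apply: addrA. Qed.
Fact dsum_addC : commutative dsumD.
Proof. by move=> x y; apply: dsumP => q; apply: addrC. Qed.
Fact dsum_add0 : left_id dsum0 dsumD.
Proof. by move=> x; apply: dsumP => q; apply: add0r. Qed.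
Fact dsum_addN : left_inverse dsum0 dsumN dsumD.
Proof. by move=> x; apply: dsumP => q; apply: addNr. Qed.

HB.instance Definition _ := GRing.isZmodule.Build (dsum P)
  dsum_addA dsum_addC dsum_add0 dsum_addN.

Lemma dsumDE x y q : (x + y) q = x q + y q. Proof. by []. Qed.
Lemma dsumNE x q : (- x) q = - x q. Proof. by []. Qed.
Lemma dsum0E q : (0 : dsum P) q = 0. Proof. by []. Qed.

End DsumTheory.

(* The library quotients abelian groups only; this adds the action of R.
   Boolean-valued submodules are no restriction, since [asbool] turns any
   Prop-valued submodule into one. *)
Section QuotientModule.
Variables (R : pzRingType) (V : lmodType R) (N : submodClosed V).

Definition qmod_pred : {pred V} := fun x => x \in N.

Fact qmod_pred_zmod : zmod_closed qmod_pred.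
Proof.
split=> [|x y xN yN]; first exact: (rpred0 N).
by rewrite -scaleN1r; apply: (@rpredD _ N) => //; apply: rpredZ.
Qed.
HB.instance Definition _ := GRing.isZmodClosed.Build V qmod_pred qmod_pred_zmod.

Definition qmod := Quotient.quot qmod_pred.
HB.instance Definition _ := GRing.Zmodule.on qmod.

Definition qmod_proj (x : V) : qmod := \pi_(Quotient.quot qmod_pred) x.

Lemma qmod_projE x y : (qmod_proj x = qmod_proj y) <-> (x - y \in N).
Proof.
rewrite /qmod_proj; split.
  by move/eqP; rewrite -Quotient.idealrBE.
by move=> h; apply/eqP; rewrite -Quotient.idealrBE.
Qed.

Lemma qmod_projD x y : qmod_proj (x + y) = qmod_proj x + qmod_proj y.
Proof. by rewrite /qmod_proj; apply: (raddfD (\pi_(Quotient.quot qmod_pred))). Qed.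

Definition qmod_scale (r : R) (x : qmod) : qmod :=
  qmod_proj (r *: repr (x : Quotient.quot qmod_pred)).

Lemma qmod_reprK (x : qmod) :
  qmod_proj (repr (x : Quotient.quot qmod_pred)) = x.
Proof. exact: reprK. Qed.

Lemma qmod_projZ r x : qmod_proj (r *: x) = qmod_scale r (qmod_proj x).
Proof.
apply/qmod_projE; rewrite -scalerBr rpredZ //.
by apply/qmod_projE; rewrite qmod_reprK.
Qed.

Lemma qmod_ind (Q : qmod -> Prop) : (forall x, Q (qmod_proj x)) -> forall x, Q x.
Proof. by move=> h x; rewrite -(qmod_reprK x). Qed.

Fact qmod_scaleA a b x : qmod_scale a (qmod_scale b x) = qmod_scale (a * b) x.
Proof. by elim/qmod_ind: x => x; rewrite -!qmod_projZ scalerA. Qed.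
Fact qmod_scale1 : left_id 1 qmod_scale.
Proof. by elim/qmod_ind=> x; rewrite -!qmod_projZ scale1r. Qed.
Fact qmod_scaleDr : right_distributive qmod_scale +%R.
Proof.
move=> a; elim/qmod_ind=> x; elim/qmod_ind=> y.
by rewrite -qmod_projD -!qmod_projZ scalerDr qmod_projD.
Qed.
Fact qmod_scaleDl x : {morph qmod_scale^~ x : a b / a + b}.
Proof.
by elim/qmod_ind: x => x a b; rewrite -!qmod_projZ scalerDl qmod_projD.
Qed.
HB.instance Definition _ := GRing.Zmodule_isLmodule.Build R qmod
  qmod_scaleA qmod_scale1 qmod_scaleDr qmod_scaleDl.

Fact qmod_proj_linear : linear qmod_proj.
Proof. by move=> a x y; rewrite qmod_projD qmod_projZ. Qed.
HB.instance Definition _ := GRing.isLinear.Build R V qmod _ qmod_proj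
  qmod_proj_linear.

End QuotientModule.

Section Resolution.
Variables (R : pzRingType) (M : lmodType R) (L : nat -> lmodType R).
Variables (phi0 : {linear L 0%N -> M}) (phi : forall i, {linear L i.+1 -> L i}).

(* [phi i] is the map from [L i.+1] to [L i], so that [res_ker i] is the
   kernel of the map leaving [L i]. *)
Definition res_ker (i : nat) : set (L i) :=
  match i return set (L i) with
  | 0%N => [set x | phi0 x = 0]
  | j.+1 => [set x | phi j x = 0]
  end.
Arguments res_ker i _ : clear implicits.

Definition res_exact : Prop :=
  range phi0 = setT /\ forall i, range (phi i) = res_ker i.

End Resolution.
Arguments res_ker {R M L} phi0 phi i _.

Definition is_grading (V : zmodType) (V_ : nat -> set V) : Prop :=
  [/\ forall q, V_ q 0 /\ (forall x y, V_ q x -> V_ q y -> V_ q (x - y)),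
      forall x, exists n (y : nat -> V),
        (forall q, V_ q (y q)) /\ x = \sum_(q < n) y q
    & forall n (y : nat -> V), (forall q, V_ q (y q)) ->
        \sum_(q < n) y q = 0 -> forall q, (q < n)%N -> y q = 0].

Definition graded_ring (R : pzRingType) (R_ : nat -> set R) : Prop :=
  [/\ is_grading R_, R_ 0%N 1
    & forall p q x y, R_ p x -> R_ q y -> R_ (p + q)%N (x * y)].

Definition graded_module (R : pzRingType) (R_ : nat -> set R)
    (V : lmodType R) (V_ : nat -> set V) : Prop :=
  is_grading V_ /\
  forall p q r x, R_ p r -> V_ q x -> V_ (p + q)%N (r *: x).

Section Generation.
Variables (R : pzRingType) (V : lmodType R) (k : nat) (v : 'I_k -> V).

Definition generated_by (J : {set 'I_k}) : set V :=
  [set x | exists c : 'I_k -> R, x = \sum_(j in J) c j *: v j].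

Definition free_basis : Prop :=
  generated_by [set: 'I_k]%SET = setT /\
  forall c : 'I_k -> R, \sum_j c j *: v j = 0 -> forall j, c j = 0.

Definition homogeneous_family (V_ : nat -> set V) : Prop :=
  forall j, exists q, V_ q (v j).

Definition min_hom_generating (V_ : nat -> set V) (W : set V) : Prop :=
  [/\ homogeneous_family V_, generated_by [set: 'I_k]%SET = W
    & forall J : {set 'I_k}, J \proper [set: 'I_k]%SET -> generated_by J <> W].

End Generation.

Definition finitely_generated (R : pzRingType) (V : lmodType R) : Prop :=
  exists k (v : 'I_k -> V), generated_by v [set: 'I_k]%SET = setT.

Section MinGradedFreeResolution.
Variables (R : pzRingType) (R_ : nat -> set R).
Variables (M : lmodType R) (M_ : nat -> set M).
Variables (L : nat -> lmodType R) (L_ : forall i, nat -> set (L i)).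
Arguments L_ : clear implicits.
Variables (phi0 : {linear L 0%N -> M}) (phi : forall i, {linear L i.+1 -> L i}).

Definition min_graded_free_resolution : Prop :=
  [/\ [/\ graded_ring R_, graded_module R_ M_
        & forall i, graded_module R_ (L_ i)],
      (forall q x, L_ 0%N q x -> M_ q (phi0 x)) /\
      (forall i q x, L_ i.+1 q x -> L_ i q (phi i x)),
      res_exact phi0 phi
    & (exists k (e : 'I_k -> L 0%N),
        [/\ free_basis e, homogeneous_family e (L_ 0%N)
          & min_hom_generating (fun j => phi0 (e j)) M_ (range phi0)]) /\
      (forall i, exists k (e : 'I_k -> L i.+1),
        [/\ free_basis e, homogeneous_family e (L_ i.+1)
          & min_hom_generating (fun j => phi i (e j)) (L_ i) (range (phi i))])].

End MinGradedFreeResolution.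

Definition Ksubspace (K : fieldType) (V : zmodType) (act : K -> V -> V)
    (S : set V) : Prop :=
  [/\ S 0, forall x y, S x -> S y -> S (x + y) & forall c x, S x -> S (act c x)].

Definition Kspan (K : fieldType) (V : zmodType) (act : K -> V -> V)
    (S : set V) : set V :=
  [set x | exists r (c : 'I_r -> K) (v : 'I_r -> V),
    (forall i, S (v i)) /\ x = \sum_i act (c i) (v i)].

Record filtAlg (K : fieldType) (A : algType K) := FiltAlg {
  fa_fil : nat -> set A;
  fa_sub : forall p, Ksubspace *:%R (fa_fil p);
  fa_inc : forall p f, fa_fil p f -> fa_fil p.+1 f;
  fa_exh : forall f, exists p, fa_fil p f;
  fa_one : fa_fil 0 1;
  fa_mul : forall p q f g, fa_fil p f -> fa_fil q g -> fa_fil (p + q)%N (f * g) }.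

(* K acts on an A-module through the structure map of A. *)
Definition kact (K : fieldType) (A : algType K) (V : lmodType A)
  (c : K) (x : V) : V := c%:A *: x.

Record filtMod (K : fieldType) (A : algType K) (FA : filtAlg A) := FiltMod {
  fm_sort :> lmodType A;
  fm_fil : nat -> set fm_sort;
  fm_sub : forall q, Ksubspace (@kact K A fm_sort) (fm_fil q);
  fm_inc : forall q x, fm_fil q x -> fm_fil q.+1 x;
  fm_exh : forall x, exists q, fm_fil q x;
  fm_mul : forall p q f x,
    fa_fil FA p f -> fm_fil q x -> fm_fil (p + q)%N (f *: x) }.

Arguments fa_fil {K A} _ _ _.
Arguments fm_fil {K A FA} _ _ _.

Record filtHom (K : fieldType) (A : algType K) (FA : filtAlg A)
    (M M' : filtMod FA) := FiltHom {
  fh_fun :> {linear M -> M'};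
  fh_fil : forall q x, fm_fil M q x -> fm_fil M' q (fh_fun x) }.

Section FilteredNotions.
Variables (K : fieldType) (A : algType K) (FA : filtAlg A).

Definition strict_filtered (M M' : filtMod FA) (phi : {linear M -> M'}) : Prop :=
  forall q, phi @` fm_fil M q = range phi `&` fm_fil M' q.

Definition strict_filtered_iso (M M' : filtMod FA) (chi : {linear M -> M'}) :
    Prop :=
  bijective chi /\ forall q, chi @` fm_fil M q = fm_fil M' q.

(* The subspace \sum_{p + n <= q} F_p A of A, zero when q < n. *)
Definition sum_fil (n q : nat) : set A :=
  [set f | exists g : nat -> A, (forall p, fa_fil FA p (g p)) /\
     f = \sum_(p < q.+1 | (p + n <= q)%N) g p].

(* [J] selects a subfamily of [v]; [FX] is a filtration of a submodule of [V],
   so that the same notion serves for F-bases and for standard bases. *)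
Definition F_basis (V : lmodType A) (FX : nat -> set V) (k : nat)
    (v : 'I_k -> V) (J : {set 'I_k}) : Prop :=
  (forall j, j \in J -> v j <> 0) /\
  exists n : 'I_k -> nat, forall q,
    FX q = [set x | exists f : 'I_k -> A,
      (forall j, sum_fil (n j) q (f j)) /\ x = \sum_(j in J) f j *: v j].

Definition min_F_basis (V : lmodType A) (FX : nat -> set V) (k : nat)
    (v : 'I_k -> V) : Prop :=
  F_basis FX v [set: 'I_k]%SET /\
  forall J : {set 'I_k}, J \proper [set: 'I_k]%SET -> ~ F_basis FX v J.

Definition min_standard_basis (M : filtMod FA) (N : set M) (k : nat)
    (v : 'I_k -> M) : Prop :=
  min_F_basis (fun q => N `&` fm_fil M q) v.

End FilteredNotions.

Section RegularModule.
Variables (K : fieldType) (A : algType K) (FA : filtAlg A).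

Fact reg_sub q : Ksubspace (@kact K A A^o) (fa_fil FA q).
Proof.
have [h0 hD hZ] := fa_sub FA q; split=> // c x /(hZ c).
by rewrite /kact -[c *: x]mulr_algl.
Qed.

Definition regMod : filtMod FA :=
  @FiltMod K A FA A^o (fa_fil FA) reg_sub (@fa_inc _ _ FA) (@fa_exh _ _ FA)
    (@fa_mul _ _ FA).

End RegularModule.

Section QuotientFiltration.
Variables (K : fieldType) (A : algType K) (FA : filtAlg A).
Variables (M : filtMod FA) (N : submodClosed M).

Definition quot_fil (q : nat) : set (qmod N) :=
  @qmod_proj A M N @` fm_fil M q.

Fact quot_sub q : Ksubspace (@kact K A (qmod N)) (quot_fil q).
Proof.
have [h0 hD hZ] := fm_sub M q; split.
- by exists 0; rewrite ?linear0.
- move=> _ _ [x xq <-] [y yq <-]; exists (x + y); first exact: hD.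
  by rewrite linearD.
- by move=> c _ [x xq <-]; exists (kact c x); [apply: hZ|rewrite /kact linearZ].
Qed.
Fact quot_inc q x : quot_fil q x -> quot_fil q.+1 x.
Proof. by case=> y yq <-; exists y => //; apply: fm_inc. Qed.
Fact quot_exh x : exists q, quot_fil q x.
Proof.
by elim/qmod_ind: x => x; have [q xq] := fm_exh x; exists q, x.
Qed.
Fact quot_mul p q f x :
  fa_fil FA p f -> quot_fil q x -> quot_fil (p + q)%N (f *: x).
Proof.
move=> fp [y yq <-]; exists (f *: y); first exact: fm_mul.
by rewrite linearZ.
Qed.

Definition quotMod : filtMod FA :=
  FiltMod quot_sub quot_inc quot_exh quot_mul.

Fact quot_proj_fil q (x : M) : fm_fil M q x -> fm_fil quotMod q (qmod_proj N x).
Proof. by move=> xq; exists x. Qed.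

Definition quotProj : filtHom M quotMod :=
  @FiltHom K A FA M quotMod (@qmod_proj A M N) quot_proj_fil.

End QuotientFiltration.

Section Pieces.
Variables (K : fieldType) (A : algType K) (FA : filtAlg A) (M : filtMod FA).
Implicit Type q : nat.

Lemma fm_fil0 q : fm_fil M q 0.
Proof. by case: (fm_sub M q). Qed.
Lemma fm_filD q x y : fm_fil M q x -> fm_fil M q y -> fm_fil M q (x + y).
Proof. by case: (fm_sub M q) => _ + _; apply. Qed.
Lemma fm_filN q x : fm_fil M q x -> fm_fil M q (- x).
Proof.
case: (fm_sub M q) => _ _ /(_ (-1) x) h /h.
by rewrite /kact scaleN1r scaleN1r.
Qed.

(* F_{q-1} M, with F_{-1} M = 0. *)
Definition fm_prev q : set M := if q is p.+1 then fm_fil M p else [set 0].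

Definition fil_pred q : {pred M} := fun x => `[< fm_fil M q x >].
Fact fil_pred_zmod q : zmod_closed (fil_pred q).
Proof.
split=> [|x y]; rewrite !unfold_in.
  by apply/asboolP; apply: fm_fil0.
by move=> /asboolP xq /asboolP yq; apply/asboolP/fm_filD/fm_filN.
Qed.
HB.instance Definition _ q :=
  GRing.isZmodClosed.Build M (fil_pred q) (fil_pred_zmod q).

Record fpart q := FPart { fp_val :> M; fp_valP : fil_pred q fp_val }.
HB.instance Definition _ q := [isSub for @fp_val q].
HB.instance Definition _ q := [Choice of fpart q by <:].
HB.instance Definition _ q := [SubChoice_isSubZmodule of fpart q by <:].

Definition prev_pred q : {pred fpart q} := fun x => `[< fm_prev q (fp_val x) >].
Arguments prev_pred : clear implicits.
Fact prev_pred_zmod q : zmod_closed (prev_pred q).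
Proof.
case: q => [|q]; split=> [|x y]; rewrite !unfold_in /=.
- by apply/asboolP.
- by move=> /asboolP xq /asboolP yq; apply/asboolP; rewrite /= xq yq subr0.
- by apply/asboolP; apply: fm_fil0.
- by move=> /asboolP xq /asboolP yq; apply/asboolP/fm_filD/fm_filN.
Qed.
HB.instance Definition _ q :=
  GRing.isZmodClosed.Build (fpart q) (prev_pred q) (prev_pred_zmod q).

Definition gpart q := Quotient.quot (prev_pred q).
HB.instance Definition _ q := GRing.Zmodule.on (gpart q).

Definition gproj q (x : fpart q) : gpart q := \pi_(Quotient.quot (prev_pred q)) x.
Definition grepr q (x : gpart q) : fpart q :=
  repr (x : Quotient.quot (prev_pred q)).

Definition Rees := dsum fpart.
Definition Gr := dsum gpart.
HB.instance Definition _ := GRing.Zmodule.on Rees.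
HB.instance Definition _ := GRing.Zmodule.on Gr.

Definition Rees_hom q : set Rees := dsum_hom q.
Definition Gr_hom q : set Gr := dsum_hom q.

Lemma fpartP q (x : fpart q) : fm_fil M q (fp_val x).
Proof. by apply/asboolP; case: x. Qed.

End Pieces.
Arguments fm_prev {K A FA} M q _.
Arguments fil_pred {K A FA} M q _.
Arguments prev_pred {K A FA} M q _.

Section Products.
Variables (K : fieldType) (A : algType K) (FA : filtAlg A) (M : filtMod FA).
Notation RA := (regMod FA).

Fact fmul_subproof p q n (h : (p + q)%N = n) (x : fpart RA p) (y : fpart M q) :
  fil_pred M n ((fp_val x : A) *: fp_val y : M).
Proof. by apply/asboolP; rewrite -h; apply: fm_mul; apply: fpartP. Qed.

Definition fmul p q n (h : (p + q)%N = n) (x : fpart RA p) (y : fpart M q) :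
  fpart M n := FPart (fmul_subproof h x y).

(* The product of the classes of x and y is the class of their product; it
   does not depend on the representatives, see [gmul_proj]. *)
Definition gmul p q n (h : (p + q)%N = n) (x : gpart RA p) (y : gpart M q) :
  gpart M n := gproj (fmul h (grepr x) (grepr y)).

Lemma gprojE q (x y : fpart M q) :
  (gproj x = gproj y) <-> fm_prev M q (fp_val x - fp_val y).
Proof.
rewrite /gproj; split.
  by move/eqP; rewrite -Quotient.idealrBE unfold_in => /asboolP.
by move=> h; apply/eqP; rewrite -Quotient.idealrBE unfold_in; apply/asboolP.
Qed.

Lemma greprK q (x : gpart M q) : gproj (grepr x) = x.
Proof. exact: reprK. Qed.

Fact gproj_additive q : zmod_morphism (@gproj K A FA M q).
Proof. by move=> x y; apply: (raddfB (\pi_(Quotient.quot (prev_pred M q)))). Qed.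
HB.instance Definition _ q :=
  GRing.isZmodMorphism.Build (fpart M q) (gpart M q) (@gproj K A FA M q)
    (@gproj_additive q).

Lemma fm_prevD q x y : fm_prev M q x -> fm_prev M q y -> fm_prev M q (x + y).
Proof. by case: q => [/= -> ->|q]; [rewrite addr0|apply: fm_filD]. Qed.

End Products.

Arguments gmul {K A FA M p q n}.
Arguments fmul {K A FA M p q n}.

Section Products2.
Variables (K : fieldType) (A : algType K) (FA : filtAlg A) (M : filtMod FA).
Notation RA := (regMod FA).

Lemma fm_prev_mul p q n (f : A) (x : M) : (p + q)%N = n ->
  fm_prev RA p f -> fm_fil M q x -> fm_prev M n (f *: x).
Proof.
move=> <-; case: p => [/= -> _|p fp xq].
  by rewrite scale0r; case: q => // q; apply: fm_fil0.
by rewrite addSn; apply: fm_mul.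
Qed.

Lemma fm_mul_prev p q n (f : A) (x : M) : (p + q)%N = n ->
  fa_fil FA p f -> fm_prev M q x -> fm_prev M n (f *: x).
Proof.
move=> <-; case: q => [/= fp -> |q fp xq].
  by rewrite scaler0 addn0; case: p fp => // p _; apply: fm_fil0.
by rewrite addnS; apply: fm_mul.
Qed.

Lemma gmul_proj p q n (h : (p + q)%N = n) (x : fpart RA p) (y : fpart M q) :
  gmul h (gproj x) (gproj y) = gproj (fmul h x y).
Proof.
apply/gprojE => /=.
set x' := fp_val (grepr _); set y' := fp_val (grepr _).
have hx : fm_prev RA p (x' - fp_val x) by apply/gprojE; rewrite greprK.
have hy : fm_prev M q (y' - fp_val y) by apply/gprojE; rewrite greprK.
have -> : (x' : A) *: y' - (fp_val x : A) *: fp_val y =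
    (x' : A) *: (y' - fp_val y) + (x' - fp_val x : A) *: fp_val y.
  by rewrite scalerBr scalerBl addrA subrK.
apply: fm_prevD; first by apply: (fm_mul_prev h) => //; apply: (fpartP (grepr _)).
by apply: (fm_prev_mul h) => //; apply: fpartP.
Qed.

Lemma gproj0 q (N : filtMod FA) : gproj (0 : fpart N q) = 0.
Proof. exact: raddf0. Qed.

Lemma gmul0l p q n (h : (p + q)%N = n) (y : gpart M q) : gmul h 0 y = 0.
Proof.
rewrite -(gproj0 p RA) -(greprK y) gmul_proj -(gproj0 n M).
by congr gproj; apply: val_inj; apply: scale0r.
Qed.

Lemma gmul0r p q n (h : (p + q)%N = n) (x : gpart RA p) :
  gmul h x (0 : gpart M q) = 0.
Proof.
rewrite -(gproj0 q M) -(greprK x) gmul_proj -(gproj0 n M).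
by congr gproj; apply: val_inj; apply: scaler0.
Qed.

Lemma fmul0l p q n (h : (p + q)%N = n) (y : fpart M q) : fmul h 0 y = 0.
Proof. by apply: val_inj; apply: scale0r. Qed.
Lemma fmul0r p q n (h : (p + q)%N = n) (x : fpart RA p) :
  fmul h x (0 : fpart M q) = 0.
Proof. by apply: val_inj; apply: scaler0. Qed.

Lemma conv_eq0 a b n (i : 'I_n.+1) :
  (a + b <= n)%N -> (a <= i)%N || (b <= n - i)%N.
Proof.
move=> h; case: leqP => //= ia.
by rewrite leq_subRL ?leq_ord // (leq_trans _ h) // leq_add2r ltnW.
Qed.

Definition rees_conv (x : Rees RA) (m : Rees M) (n : nat) : fpart M n :=
  \sum_(i < n.+1) fmul (subnKC (leq_ord i)) (x i) (m (n - i)%N).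

Fact rees_conv_fin x m :
  exists n, forall q, (n <= q)%N -> rees_conv x m q = 0.
Proof.
have [a ha] := dsum_fin x; have [b hb] := dsum_fin m.
exists (a + b)%N => q hq; apply: big1 => i _.
by case/orP: (conv_eq0 i hq) => [/ha|/hb] ->; rewrite ?fmul0l ?fmul0r.
Qed.
Definition rees_scale (x : Rees RA) (m : Rees M) : Rees M :=
  Dsum (rees_conv_fin x m).

Definition gr_conv (x : Gr RA) (m : Gr M) (n : nat) : gpart M n :=
  \sum_(i < n.+1) gmul (subnKC (leq_ord i)) (x i) (m (n - i)%N).

Fact gr_conv_fin x m :
  exists n, forall q, (n <= q)%N -> gr_conv x m q = 0.
Proof.
have [a ha] := dsum_fin x; have [b hb] := dsum_fin m.
exists (a + b)%N => q hq; apply: big1 => i _.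
by case/orP: (conv_eq0 i hq) => [/ha|/hb] ->; rewrite ?gmul0l ?gmul0r.
Qed.
Definition gr_scale (x : Gr RA) (m : Gr M) : Gr M := Dsum (gr_conv_fin x m).

(* The canonical map from the Rees module onto the associated graded one. *)
Fact rees_to_gr_fin (x : Rees M) :
  exists n, forall q, (n <= q)%N -> gproj (x q) = 0.
Proof. by have [a ha] := dsum_fin x; exists a => q /ha ->; apply: gproj0. Qed.
Definition rees_to_gr (x : Rees M) : Gr M := Dsum (rees_to_gr_fin x).

Lemma rees_to_gr_surj (x : Gr M) : exists y, rees_to_gr y = x.
Proof.
have [a ha] := dsum_fin x.
pose f q : fpart M q := if (a <= q)%N then 0 else grepr (x q).
have hf : exists n, forall q, (n <= q)%N -> f q = 0.
  by exists a => q; rewrite /f => ->.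
exists (Dsum hf); apply: dsumP => q /=; rewrite /f.
by case: ifP => [/ha ->|_]; [apply: gproj0|apply: greprK].
Qed.

Lemma rees_to_gr_ind (Q : Gr M -> Prop) :
  (forall x, Q (rees_to_gr x)) -> forall x, Q x.
Proof. by move=> h x; have [y <-] := rees_to_gr_surj x. Qed.

Lemma rees_to_grD x y : rees_to_gr (x + y) = rees_to_gr x + rees_to_gr y.
Proof. by apply: dsumP => q; apply: raddfD. Qed.

Lemma rees_scaleE x m n : fp_val (rees_scale x m n) =
  \sum_(i < n.+1) (fp_val (x i) : A) *: fp_val (m (n - i)%N).
Proof. exact: (raddf_sum (\val : fpart M n -> M)). Qed.

Lemma rees_scaleDr x : {morph rees_scale x : m1 m2 / m1 + m2}.
Proof.
move=> m1 m2; apply: dsumP => n; rewrite dsumDE /= /rees_conv -big_split.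
apply: eq_bigr => i _.
by apply: val_inj; apply: scalerDr.
Qed.
Lemma rees_scaleDl m : {morph rees_scale^~ m : x y / x + y}.
Proof.
move=> x y; apply: dsumP => n; rewrite dsumDE /= /rees_conv -big_split.
apply: eq_bigr => i _.
by apply: val_inj; apply: scalerDl.
Qed.

Lemma conv_scaleA (X Y : nat -> A) (Z : nat -> M) n :
  \sum_(k < n.+1) (\sum_(i < k.+1) X i * Y (k - i)%N) *: Z (n - k)%N =
  \sum_(i < n.+1) X i *: \sum_(j < (n - i).+1) Y j *: Z (n - i - j)%N.
Proof.
transitivity (\sum_(k < n.+1) \sum_(i < n.+1 | (i < k.+1)%N)
    X i *: (Y (k - i)%N *: Z (n - k)%N)).
  apply: eq_bigr => k _; rewrite scaler_suml.
  rewrite (@big_ord_widen M 0 +%R k.+1 n.+1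
    (fun i => (X i * Y (k - i)%N) *: Z (n - k)%N) (ltn_ord k)).
  by apply: eq_bigr => i _; rewrite scalerA.
rewrite (exchange_big_dep xpredT) //=; apply: eq_bigr => i _.
rewrite scaler_sumr -(big_geq_mkord _ _ xpredT
  (fun k => X i *: (Y (k - i)%N *: Z (n - k)%N))) /=.
rewrite -{1}[nat_of_ord i]add0n big_addn subSn ?leq_ord // big_mkord.
by apply: eq_bigr => j _; rewrite addnK [(j + i)%N]addnC subnDA.
Qed.

End Products2.

Section ReesRing.
Variables (K : fieldType) (A : algType K) (FA : filtAlg A).
Notation RA := (regMod FA).

Lemma rees_scaleA (M : filtMod FA) (x y : Rees RA) (m : Rees M) :
  rees_scale (rees_scale x y) m = rees_scale x (rees_scale y m).
Proof.
apply: dsumP => n; apply: val_inj => /=.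
rewrite (rees_scaleE (rees_scale x y)) (rees_scaleE x).
apply: (etrans _ (etrans (conv_scaleA (fun i => fp_val (x i) : A)
  (fun i => fp_val (y i) : A) (fun i => fp_val (m i)) n) _));
  by apply: eq_bigr => i _; rewrite rees_scaleE.
Qed.

Definition rees_one_fun q : fpart RA q :=
  match q with
  | 0%N => @FPart K A FA RA 0 (1 : A) (asboolT (fa_one FA))
  | _.+1 => 0
  end.
Fact rees_one_fin : exists n, forall q, (n <= q)%N -> rees_one_fun q = 0.
Proof. by exists 1%N; case. Qed.
Definition rees_one : Rees RA := Dsum rees_one_fin.

Lemma rees_scale1 (M : filtMod FA) (m : Rees M) : rees_scale rees_one m = m.
Proof.
apply: dsumP => n; apply: val_inj; rewrite /= rees_scaleE big_ord_recl /=.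
by rewrite scale1r subn0 big1 ?addr0 // => i _; rewrite scale0r.
Qed.

Lemma rees_mulr1 (x : Rees RA) : rees_scale x rees_one = x.
Proof.
apply: dsumP => n; apply: val_inj; rewrite /= rees_scaleE big_ord_recr /=.
rewrite subnn big1 ?add0r => [|i _]; first exact: mulr1.
by rewrite -subnSK ?ltn_ord // scaler0.
Qed.

(* The multiplication of the Rees ring is the action of the Rees ring on the
   Rees module of the regular module A; likewise for [gr_ring]. *)
Definition rees_ring : Type := Rees RA.
HB.instance Definition _ := GRing.Zmodule.on rees_ring.

Definition rees_mul (x y : rees_ring) : rees_ring := rees_scale x y.

Fact rees_mulA : associative rees_mul.
Proof. by move=> x y z; rewrite /rees_mul rees_scaleA. Qed.
Fact rees_mul1r : left_id (rees_one : rees_ring) rees_mul.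
Proof. exact: rees_scale1. Qed.
Fact rees_mulr1' : right_id (rees_one : rees_ring) rees_mul.
Proof. exact: rees_mulr1. Qed.
Fact rees_mulDl : left_distributive rees_mul +%R.
Proof. by move=> x y z; apply: rees_scaleDl. Qed.
Fact rees_mulDr : right_distributive rees_mul +%R.
Proof. by move=> x y z; apply: rees_scaleDr. Qed.
HB.instance Definition _ := GRing.Zmodule_isPzRing.Build rees_ring
  rees_mulA rees_mul1r rees_mulr1' rees_mulDl rees_mulDr.

Variable M : filtMod FA.
Fact rees_scaleA' (a b : rees_ring) (v : Rees M) :
  rees_scale a (rees_scale b v) = rees_scale (a * b) v.
Proof. by rewrite -rees_scaleA. Qed.
HB.instance Definition _ := @GRing.Zmodule_isLmodule.Build rees_ring (Rees M)
  (@rees_scale K A FA M) rees_scaleA' (@rees_scale1 M) (@rees_scaleDr _ _ _ M)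
  (@rees_scaleDl _ _ _ M).

End ReesRing.

Section GrRing.
Variables (K : fieldType) (A : algType K) (FA : filtAlg A).
Notation RA := (regMod FA).

Lemma rees_to_gr_scale (M : filtMod FA) (x : Rees RA) (m : Rees M) :
  rees_to_gr (rees_scale x m) = gr_scale (rees_to_gr x) (rees_to_gr m).
Proof.
apply: dsumP => n /=; rewrite /gr_conv /rees_conv raddf_sum.
by apply: eq_bigr => i _; rewrite gmul_proj.
Qed.

Lemma gr_scaleA (M : filtMod FA) (x y : Gr RA) (m : Gr M) :
  gr_scale (gr_scale x y) m = gr_scale x (gr_scale y m).
Proof.
elim/rees_to_gr_ind: x => x; elim/rees_to_gr_ind: y => y.
elim/rees_to_gr_ind: m => m.
by rewrite -!rees_to_gr_scale rees_scaleA.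
Qed.

Definition gr_one : Gr RA := rees_to_gr (rees_one FA).

Lemma gr_scale1 (M : filtMod FA) (m : Gr M) : gr_scale gr_one m = m.
Proof. by elim/rees_to_gr_ind: m => m; rewrite -rees_to_gr_scale rees_scale1. Qed.

Lemma gr_scaleDr (M : filtMod FA) (x : Gr RA) :
  {morph @gr_scale K A FA M x : m1 m2 / m1 + m2}.
Proof.
elim/rees_to_gr_ind: x => x; elim/rees_to_gr_ind=> y; elim/rees_to_gr_ind=> z.
by rewrite -rees_to_grD -!rees_to_gr_scale rees_scaleDr rees_to_grD.
Qed.

Lemma gr_scaleDl (M : filtMod FA) (m : Gr M) :
  {morph (@gr_scale K A FA M)^~ m : x y / x + y}.
Proof.
elim/rees_to_gr_ind: m => m; elim/rees_to_gr_ind=> y; elim/rees_to_gr_ind=> z.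
by rewrite -rees_to_grD -!rees_to_gr_scale rees_scaleDl rees_to_grD.
Qed.

Definition gr_ring : Type := Gr RA.
HB.instance Definition _ := GRing.Zmodule.on gr_ring.

Definition gr_mul (x y : gr_ring) : gr_ring := gr_scale x y.

Fact gr_mulA : associative gr_mul.
Proof. by move=> x y z; rewrite /gr_mul gr_scaleA. Qed.
Fact gr_mul1r : left_id (gr_one : gr_ring) gr_mul.
Proof. exact: gr_scale1. Qed.
Fact gr_mulr1 : right_id (gr_one : gr_ring) gr_mul.
Proof.
by elim/rees_to_gr_ind=> x; rewrite /gr_mul -rees_to_gr_scale rees_mulr1.
Qed.
Fact gr_mulDl : left_distributive gr_mul +%R.
Proof. by move=> x y z; apply: gr_scaleDl. Qed.
Fact gr_mulDr : right_distributive gr_mul +%R.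
Proof. by move=> x y z; apply: gr_scaleDr. Qed.
HB.instance Definition _ := GRing.Zmodule_isPzRing.Build gr_ring
  gr_mulA gr_mul1r gr_mulr1 gr_mulDl gr_mulDr.

Variable M : filtMod FA.
Fact gr_scaleA' (a b : gr_ring) (v : Gr M) :
  gr_scale a (gr_scale b v) = gr_scale (a * b) v.
Proof. by rewrite -gr_scaleA. Qed.
HB.instance Definition _ := @GRing.Zmodule_isLmodule.Build gr_ring (Gr M)
  (@gr_scale K A FA M) gr_scaleA' (@gr_scale1 M) (@gr_scaleDr M) (@gr_scaleDl M).

End GrRing.

Section InducedMaps.
Variables (K : fieldType) (A : algType K) (FA : filtAlg A).
Variables (M M' : filtMod FA) (phi : filtHom M M').

Fact fpart_map_subproof q (x : fpart M q) : fil_pred M' q (phi (fp_val x)).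
Proof. by apply/asboolP; apply: fh_fil; apply: fpartP. Qed.
Definition fpart_map q (x : fpart M q) : fpart M' q :=
  FPart (fpart_map_subproof x).

Definition gpart_map q (x : gpart M q) : gpart M' q :=
  gproj (fpart_map (grepr x)).

Lemma fpart_map0 q : fpart_map (0 : fpart M q) = 0.
Proof. by apply: val_inj; apply: (linear0 phi). Qed.

Lemma fh_prev q z : fm_prev M q z -> fm_prev M' q (phi z).
Proof. by case: q => [/= ->|q]; [apply: linear0|apply: fh_fil]. Qed.

Lemma gpart_map_proj q (x : fpart M q) :
  gpart_map (gproj x) = gproj (fpart_map x).
Proof.
apply/gprojE => /=; rewrite -linearB; apply: fh_prev.
by apply/gprojE; rewrite greprK.
Qed.

Fact rees_map_fin (x : Rees M) :
  exists n, forall q, (n <= q)%N -> fpart_map (x q) = 0.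
Proof. by have [a ha] := dsum_fin x; exists a => q /ha ->; apply: fpart_map0. Qed.
Definition rees_map (x : Rees M) : Rees M' := Dsum (rees_map_fin x).

Fact gr_map_fin (x : Gr M) :
  exists n, forall q, (n <= q)%N -> gpart_map (x q) = 0.
Proof.
have [a ha] := dsum_fin x; exists a => q /ha ->.
by rewrite -(gproj0 q M) gpart_map_proj fpart_map0 gproj0.
Qed.
Definition gr_map (x : Gr M) : Gr M' := Dsum (gr_map_fin x).

Fact rees_map_linear :
  @GRing.linear_for (rees_ring FA) (Rees M) (Rees M') *:%R rees_map.
Proof.
move=> a x y; apply: dsumP => n; apply: val_inj.
change (phi (fp_val (rees_scale a x n) + fp_val (y n)) =
  fp_val (rees_scale a (rees_map x) n) + phi (fp_val (y n))).
rewrite linearD !rees_scaleE linear_sum; congr (_ + _).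
by apply: eq_bigr => i _; rewrite linearZ.
Qed.
HB.instance Definition _ := GRing.isLinear.Build (rees_ring FA) (Rees M)
  (Rees M') _ rees_map rees_map_linear.

Lemma gr_map_to_gr x : gr_map (rees_to_gr x) = rees_to_gr (rees_map x).
Proof. by apply: dsumP => q; apply: gpart_map_proj. Qed.

Fact gr_map_linear :
  @GRing.linear_for (gr_ring FA) (Gr M) (Gr M') *:%R gr_map.
Proof.
elim/rees_to_gr_ind=> a; elim/rees_to_gr_ind=> x; elim/rees_to_gr_ind=> y.
change (gr_map (gr_scale (rees_to_gr a) (rees_to_gr x) + rees_to_gr y) =
  gr_scale (rees_to_gr a) (gr_map (rees_to_gr x)) + gr_map (rees_to_gr y)).
rewrite -rees_to_gr_scale -rees_to_grD !gr_map_to_gr -rees_to_gr_scale.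
rewrite -rees_to_grD; congr rees_to_gr.
exact: rees_map_linear.
Qed.
HB.instance Definition _ := GRing.isLinear.Build (gr_ring FA) (Gr M)
  (Gr M') _ gr_map gr_map_linear.

End InducedMaps.

Definition expo (n : nat) : Type := {ffun 'I_n -> nat}.
HB.instance Definition _ n := Choice.on (expo n).

Definition expo0 n : expo n := [ffun => 0%N].
Definition expoD n (al be : expo n) : expo n := [ffun i => (al i + be i)%N].
Definition wdeg n (w : 'I_n -> nat) (al : expo n) : nat :=
  (\sum_(i < n) w i * al i)%N.

Section Monomials.
Variables (K : fieldType) (A : algType K) (n : nat) (a : 'I_n -> A).
Variable lt : expo n -> expo n -> Prop.

Definition mono (al : expo n) : A := \prod_(i < n) a i ^+ al i.

Definition mono_comb (s : seq (expo n)) (c : expo n -> K) : A :=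
  \sum_(al <- s) c al *: mono al.

Definition mono_basis : Prop :=
  (forall f, exists s c, f = mono_comb s c) /\
  (forall s c, uniq s -> mono_comb s c = 0 -> {in s, forall al, c al = 0}).

Definition occurs (al : expo n) (f : A) : Prop :=
  exists s c, [/\ uniq s, f = mono_comb s c, al \in s & c al <> 0].

Definition is_LM (f : A) (al : expo n) : Prop :=
  occurs al f /\ forall be, occurs be f -> be <> al -> lt be al.

Definition scalar (f : A) : Prop := exists c : K, f = c%:A.

Definition subalgebra (T : set A) : Prop :=
  [/\ T 1, forall x y, T x -> T y -> T (x + y),
      forall x y, T x -> T y -> T (x * y)
    & forall (c : K) x, T x -> T (c *: x)].

Definition generates_alg (J : {set 'I_n}) : Prop :=
  forall T, subalgebra T -> (forall i, i \in J -> T (a i)) -> forall f, T f.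

End Monomials.

(* Monomials are represented by their exponents, which [sp_basis] makes
   faithful: the ordering of the basis is an ordering [sp_lt] of exponents. *)
Record solvPolyAlg (K : fieldType) (A : algType K) := SolvPolyAlg {
  sp_n : nat;
  sp_gen : 'I_sp_n -> A;
  sp_lt : expo sp_n -> expo sp_n -> Prop;
  sp_generates : generates_alg sp_gen [set: 'I_sp_n]%SET;
  sp_minimal : forall J : {set 'I_sp_n}, J \proper [set: 'I_sp_n]%SET ->
    ~ generates_alg sp_gen J;
  sp_basis : mono_basis sp_gen;
  sp_irr : forall al, ~ sp_lt al al;
  sp_trans : forall al be ga, sp_lt al be -> sp_lt be ga -> sp_lt al ga;
  sp_total : forall al be, al <> be -> sp_lt al be \/ sp_lt be al;
  sp_wf : well_founded sp_lt;
  sp_mul : forall al be ga eta mu nu, sp_lt al be ->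
    is_LM sp_gen sp_lt
      (mono sp_gen ga * mono sp_gen al * mono sp_gen eta) mu ->
    is_LM sp_gen sp_lt
      (mono sp_gen ga * mono sp_gen be * mono sp_gen eta) nu ->
    ~ scalar (mono sp_gen mu) -> ~ scalar (mono sp_gen nu) -> sp_lt mu nu;
  sp_div : forall al be ga eta, be <> ga ->
    is_LM sp_gen sp_lt
      (mono sp_gen al * mono sp_gen be * mono sp_gen eta) ga -> sp_lt be ga;
  sp_solv : forall al be, exists (l : K) (f : A),
    [/\ l != 0,
        mono sp_gen al * mono sp_gen be = l *: mono sp_gen (expoD al be) + f
      & f = 0 \/ exists mu, is_LM sp_gen sp_lt f mu /\
                            sp_lt mu (expoD al be)] }.

Definition wfil (K : fieldType) (A : algType K) (n : nat) (a : 'I_n -> A)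
    (w : 'I_n -> nat) (p : nat) : set A :=
  Kspan *:%R [set f | exists al, (wdeg w al <= p)%N /\ f = mono a al].

Record wfSolvPolyAlg (K : fieldType) (A : algType K) := WfSolvPolyAlg {
  wf_sp :> solvPolyAlg A;
  wf_wt : 'I_(sp_n wf_sp) -> nat;
  wf_wt_gt0 : forall i, (0 < wf_wt i)%N;
  wf_mul : forall p q f g, wfil (@sp_gen K A wf_sp) wf_wt p f ->
    wfil (@sp_gen K A wf_sp) wf_wt q g ->
    wfil (@sp_gen K A wf_sp) wf_wt (p + q)%N (f * g) }.

Section KspanTheory.
Variables (K : fieldType) (V : zmodType) (act : K -> V -> V).
Hypothesis act0 : forall c, act c 0 = 0.
Hypothesis actD : forall c, {morph act c : x y / x + y}.
Hypothesis actA : forall c d x, act c (act d x) = act (c * d) x.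
Hypothesis act1 : forall x, act 1 x = x.

Lemma Kspan_sub (S : set V) : Ksubspace act (Kspan act S).
Proof.
split.
- exists 0%N, (fun=> 0), (fun=> 0); split; first by case.
  by rewrite big_ord0.
- move=> x y [r [c [v [hv ->]]]] [r' [c' [v' [hv' ->]]]].
  exists (r + r')%N.
  exists (fun i => match split i with inl j => c j | inr j => c' j end).
  exists (fun i => match split i with inl j => v j | inr j => v' j end).
  split; first by move=> i; case: (split i).
  rewrite big_split_ord; congr (_ + _); apply: eq_bigr => i _.
    by rewrite -[lshift _ _]/(unsplit (inl i)) unsplitK.
  by rewrite -[rshift _ _]/(unsplit (inr i)) unsplitK.
- move=> d x [r [c [v [hv ->]]]].
  exists r, (fun i => d * c i), v; split=> //.
  rewrite (big_morph _ (actD d) (act0 d)).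
  by apply: eq_bigr => i _; rewrite actA.
Qed.

Lemma Kspan_in (S : set V) x : S x -> Kspan act S x.
Proof.
move=> Sx; exists 1%N, (fun=> 1), (fun=> x); split=> //.
by rewrite big_ord1 act1.
Qed.

Lemma Kspan_ind (S T : set V) : Ksubspace act T -> (forall x, S x -> T x) ->
  forall x, Kspan act S x -> T x.
Proof.
move=> [T0 TD TZ] ST x [r [c [v [hv ->]]]].
by apply: (big_ind T) => // i _; apply/TZ/ST.
Qed.

End KspanTheory.

Section WfFiltration.
Variables (K : fieldType) (A : algType K) (P : wfSolvPolyAlg A).
Notation a := (@sp_gen K A P).
Notation w := (@wf_wt K A P).

Fact wf_sub p : Ksubspace *:%R (wfil a w p).
Proof.
apply: Kspan_sub => [c|c x y|c d x]; [exact: scaler0|exact: scalerDr|].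
exact: scalerA.
Qed.
Fact wf_mono al p : (wdeg w al <= p)%N -> wfil a w p (mono a al).
Proof. by move=> h; apply: (Kspan_in (@scale1r _ _)); exists al. Qed.
Fact wf_inc p f : wfil a w p f -> wfil a w p.+1 f.
Proof.
apply: Kspan_ind; first exact: wf_sub.
by move=> x [al [le_p ->]]; apply: wf_mono; apply: leqW.
Qed.
Fact wf_exh f : exists p, wfil a w p f.
Proof.
have [/(_ f) [s [c ->]] _] := sp_basis P.
pose p := (\max_(al <- s) wdeg w al)%N; exists p.
have hp al : al \in s -> (wdeg w al <= p)%N by move=> als; apply: leq_bigmax_seq.
have [h0 hD hZ] := wf_sub p.
rewrite /mono_comb big_seq; apply: (big_ind (wfil a w p)) => // al /hp als.
by apply/hZ/wf_mono.
Qed.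
Fact wf_one : wfil a w 0 1.
Proof.
have -> : 1 = mono a (expo0 _).
  by rewrite /mono big1 // => i _; rewrite ffunE expr0.
by apply: wf_mono; rewrite /wdeg big1 // => i _; rewrite ffunE muln0.
Qed.

Definition wf_filtAlg : filtAlg A :=
  FiltAlg wf_sub wf_inc wf_exh wf_one (@wf_mul _ _ P).

Record freeData := FreeData { fd_rank : nat; fd_deg : 'I_fd_rank -> nat }.

Variable D : freeData.
Notation L := 'rV[A]_(fd_rank D).
Notation b := (@fd_deg D).

Definition std_basis (j : 'I_(fd_rank D)) : L := delta_mx 0 j.

Definition free_fil (q : nat) : set L :=
  Kspan (@kact K A L) [set x | exists al j,
    (wdeg w al + b j <= q)%N /\ x = mono a al *: std_basis j].

Fact free_sub q : Ksubspace (@kact K A L) (free_fil q).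
Proof.
apply: Kspan_sub => [c|c x y|c d x]; rewrite /kact; first exact: scaler0.
  exact: scalerDr.
by rewrite scalerA mulr_algl scalerA.
Qed.

Fact free_coef p q j f : wfil a w p f -> (p + b j <= q)%N ->
  free_fil q (f *: std_basis j).
Proof.
move=> fp le_q; move: f fp; apply: Kspan_ind.
  have [h0 hD hZ] := free_sub q; split.
  - by rewrite scale0r.
  - by move=> x y hx hy; rewrite scalerDl; apply: hD.
  - move=> c x /(hZ c); rewrite /kact scalerA.
    by rewrite mulr_algl.
move=> f [al [le_p ->]]; apply: Kspan_in => [x|].
  by rewrite /kact scale1r scale1r.
by exists al, j; split=> //; apply: leq_trans le_q; rewrite leq_add2r.
Qed.

Fact free_inc q x : free_fil q x -> free_fil q.+1 x.
Proof.
apply: Kspan_ind; first exact: free_sub.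
move=> _ [al [j [le_q ->]]]; apply: (@free_coef (wdeg w al)) (leqW le_q).
exact: wf_mono.
Qed.

Fact free_inc_le q q' x : (q <= q')%N -> free_fil q x -> free_fil q' x.
Proof.
move=> /subnKC <- h; elim: (q' - q)%N => [|k IH]; first by rewrite addn0.
by rewrite addnS; apply: free_inc.
Qed.

Fact free_exh x : exists q, free_fil q x.
Proof.
rewrite (matrix_sum_delta x) big_ord1.
elim/big_ind: _ => [|y z [p hp] [q hq]|j _].
- by exists 0%N; case: (free_sub 0).
- exists (p + q)%N; have [_ hD _] := free_sub (p + q).
  apply: hD; first exact: (free_inc_le (leq_addr q p)).
  exact: (free_inc_le (leq_addl p q)).
- have [p hp] := wf_exh (x 0 j).
  by exists (p + b j)%N; apply: (free_coef hp).
Qed.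

Fact free_mul p q f x : fa_fil wf_filtAlg p f -> free_fil q x ->
  free_fil (p + q)%N (f *: x).
Proof.
move=> fp; have [h0 hD hZ] := free_sub (p + q).
move: x; apply: Kspan_ind; first split.
- by rewrite scaler0.
- by move=> x y hx hy; rewrite scalerDr; apply: hD.
- move=> c x /(hZ c); rewrite /kact !scalerA.
  by rewrite mulr_algl mulr_algr.
move=> _ [al [j [le_q ->]]]; rewrite scalerA.
apply: (@free_coef (p + wdeg w al)); last by rewrite -addnA leq_add2l.
by apply: wf_mul => //; apply: wf_mono.
Qed.

Definition freeMod : filtMod wf_filtAlg :=
  @FiltMod K A wf_filtAlg L free_fil free_sub free_inc free_exh free_mul.

End WfFiltration.

Section MinFilteredFreeResolution.
Variables (K : fieldType) (A : algType K) (P : wfSolvPolyAlg A).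
Variables (D0 : freeData) (D : nat -> freeData).

Definition res_data (i : nat) : freeData := if i is j.+1 then D j else D0.

Definition res_mod (i : nat) : filtMod (wf_filtAlg P) := freeMod P (res_data i).

Definition res_basis (i : nat) : 'I_(fd_rank (res_data i)) -> res_mod i :=
  @std_basis K A (res_data i).

Variable N : submodClosed (freeMod P D0).
Variable phi : forall i, filtHom (res_mod i.+1) (res_mod i).

Definition min_filt_free_resolution : Prop :=
  [/\ min_F_basis (wf_filtAlg P) (fm_fil (quotMod N))
        (fun j => quotProj N (res_basis (i := 0) j)),
      @res_exact A (quotMod N) res_mod (quotProj N) phi,
      forall i, strict_filtered (phi i)
    & forall i, min_standard_basis
        (@res_ker A (quotMod N) res_mod (quotProj N) phi i)
        (fun j => phi i (res_basis (i := i.+1) j))].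

End MinFilteredFreeResolution.

(* Main.v *)
Require Import Defs.
From HB Require Import structures.
From mathcomp Require Import all_boot all_order all_algebra.
From mathcomp Require Import boolp classical_sets.

Set Implicit Arguments.
Unset Strict Implicit.
Unset Printing Implicit Defensive.

Import GRing.Theory.
Local Open Scope ring_scope.
Local Open Scope classical_set_scope.

(** Write L_i for the modules of the resolution, phi_i for the map from L_i to
L_(i-1), b_j for the filtration degrees of the basis elements e_j of L_i, and
v_j for the images of the e_j under phi_i.

Strictness of phi_i and exactness at L_(i-1) say together that
Ker phi_(i-1), with its induced filtration, is filtered by
phi_i(F_q L_i) = sum_j F_(q - b_j)A v_j.  Hence the degrees b_j of the basis are
themselves witnesses that the v_j form an F-basis, and irredundancy says that no
proper subfamily satisfies the same identities with the b_j
([min_F_basis_irredundant]).  The projection of L_0 onto M is strict as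
well, and M is filtered by the images of the F_q L_0 in the same way.

Parts (i) and (ii).  Membership in the submodule of the Rees module generated by
elements v_j placed in degree b_j is checked degree by degree: the condition in
degree q is membership in sum_j F_(q - b_j)A v_j ([rees_generated]), and for the
associated graded module it is membership modulo F_(q-1) ([gr_generated]).
Exactness thus becomes strictness and exactness in each degree
([rees_map_exact], [gr_map_exact]); the modules induced by a filtered free
module are free because F_q L is the direct sum of the F_(q - b_j)A e_j; and a
proper generating subfamily of the Rees module would contradict irredundancy at
once.  A proper generating subfamily of the graded module would do so as well,
by induction on q: it yields phi_i(F_q L_i) up to an element of F_(q-1), which
strictness puts into phi_i(F_(q-1) L_i).

Part (iii).  Since the weights are positive, F_0 A = K.  A relation among the
v_j in filtration degree q therefore has coefficient 0 at every e_l with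
b_l = q: otherwise this coefficient would be a unit and v_l would be redundant
([min_F_basis_relation]).  Given chi_i, the maps chi_i phi_(i+1) and phi'_(i+1)
have the same image in each filtration degree, so that they lift through each
other to filtered maps chi and psi.  The composites psi chi and chi psi differ
from the identity by maps with values in relations, hence by maps that are
strictly triangular for the degrees b_j; so both composites are bijective on
every F_q ([theta_inj], [theta_surj]), and chi is a strict filtered isomorphism
([minimal_cover_unique]).  As it commutes with the differentials it identifies
the kernels, and the construction continues. *)

(** * Gradings of direct sums, Rees modules and associated graded modules *)

Section Gradings.

Lemma dsum_sumE (P : nat -> zmodType) I (r : seq I) (Q : pred I)
    (F : I -> dsum P) q :
  (\sum_(i <- r | Q i) F i) q = \sum_(i <- r | Q i) F i q.
Proof. by apply: (big_morph (fun x : dsum P => x q)). Qed.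

Lemma dsum_grading (P : nat -> zmodType) : is_grading (@dsum_hom P).
Proof.
split.
- move=> q; split=> [j _ //|x y hx hy j jq].
  by rewrite dsumDE dsumNE hx // hy // subr0.
- move=> x; have [n hn] := dsum_fin x.
  pose y q j : P j := if j == q then x j else 0.
  have yfin q : exists m, forall j, (m <= j)%N -> y q j = 0.
    exists q.+1 => j qj; rewrite /y; case: eqP => // jq.
    by rewrite jq ltnn in qj.
  exists n, (fun q => Dsum (yfin q)); split=> [q j jq /=|].
    by rewrite /y; case: eqP.
  apply: dsumP => j; rewrite dsum_sumE /= /y.
  have [jn|jn] := ltnP j n.
    rewrite (bigD1 (Ordinal jn)) //= eqxx big1 ?addr0 // => i ij.
    case: eqP => // ji; case/negP: ij; apply/eqP/val_inj; exact: esym.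
  by rewrite hn // big1 // => i _; case: eqP.
- move=> n y hy y0 q qn; apply: dsumP => j.
  have [->|jq] := pselect (j = q); last by rewrite hy.
  have := congr1 (fun x : dsum P => x q) y0; rewrite /= dsum_sumE.
  rewrite (bigD1 (Ordinal qn)) //= big1 ?addr0 // => i iq.
  by apply: hy => qi; case/negP: iq; apply/eqP/val_inj; exact: esym.
Qed.

End Gradings.

Section Filtered.
Variables (K : fieldType) (A : algType K) (FA : filtAlg A).
Notation RA := (regMod FA).
Implicit Types M X Y Z : filtMod FA.

Lemma rees_hom_scale M p q (r : rees_ring FA) (x : Rees M) :
  Rees_hom p r -> Rees_hom q x -> Rees_hom (p + q)%N (r *: x).
Proof.
move=> hr hx n npq; apply: val_inj; apply: (etrans (rees_scaleE r x n)).
apply: big1 => i _; have [ip|ip] := pselect (nat_of_ord i = p).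
  rewrite hx ?scaler0 // => niq; apply: npq.
  by rewrite -ip -niq subnKC // -ltnS ltn_ord.
by rewrite hr // scale0r.
Qed.

Lemma rees_graded_module M : graded_module
  (R := rees_ring FA) (@Rees_hom K A FA RA) (@Rees_hom K A FA M).
Proof. by split; [apply: dsum_grading|apply: rees_hom_scale]. Qed.

Lemma rees_graded_ring : graded_ring (R := rees_ring FA) (@Rees_hom K A FA RA).
Proof.
split; [exact: dsum_grading|by case|exact: (@rees_hom_scale RA)].
Qed.

Lemma gr_hom_lift M q (x : Gr M) : Gr_hom q x ->
  exists2 y : Rees M, Rees_hom q y & rees_to_gr y = x.
Proof.
move=> hx.
pose f j : fpart M j := if j == q then grepr (x j) else 0.
have hf : exists n, forall j, (n <= j)%N -> f j = 0.
  by exists q.+1 => j qj; rewrite /f; case: eqP => // jq; rewrite jq ltnn in qj.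
exists (Dsum hf) => [j jq /=|]; first by rewrite /f; case: eqP.
apply: dsumP => j /=; rewrite /f; case: eqP => [_|jq]; first exact: greprK.
by rewrite gproj0 hx.
Qed.

Lemma rees_to_gr_hom M q (x : Rees M) : Rees_hom q x -> Gr_hom q (rees_to_gr x).
Proof. by move=> hx j jq /=; rewrite hx // gproj0. Qed.

Lemma gr_hom_scale M p q (r : gr_ring FA) (x : Gr M) :
  Gr_hom p r -> Gr_hom q x -> Gr_hom (p + q)%N (r *: x).
Proof.
move=> /gr_hom_lift [r' hr <-] /gr_hom_lift [x' hx <-].
apply: (eq_ind _ (Gr_hom (p + q)%N) _ _ (rees_to_gr_scale r' x')).
by apply/rees_to_gr_hom/rees_hom_scale.
Qed.

Lemma gr_graded_module M : graded_module
  (R := gr_ring FA) (@Gr_hom K A FA RA) (@Gr_hom K A FA M).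
Proof. by split; [apply: dsum_grading|apply: gr_hom_scale]. Qed.

Lemma gr_graded_ring : graded_ring (R := gr_ring FA) (@Gr_hom K A FA RA).
Proof.
split; [exact: dsum_grading| |exact: (@gr_hom_scale RA)].
by apply: (rees_to_gr_hom (q := 0)); case.
Qed.

Lemma rees_map_hom X Y (h : filtHom X Y) q x :
  Rees_hom q x -> Rees_hom q (rees_map h x).
Proof. by move=> hx j jq /=; rewrite hx // fpart_map0. Qed.

Lemma gr_map_hom X Y (h : filtHom X Y) q x :
  Gr_hom q x -> Gr_hom q (gr_map h x).
Proof.
move=> /gr_hom_lift[y hy <-]; rewrite gr_map_to_gr.
by apply/rees_to_gr_hom/rees_map_hom.
Qed.

(** * Ranges and exactness of the induced maps *)

Lemma reesP M (x y : Rees M) :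
  (forall q, fp_val (x q) = fp_val (y q)) -> x = y.
Proof. by move=> xy; apply: dsumP => q; apply: val_inj; apply: xy. Qed.

Lemma rees_to_grE M (x y : Rees M) : rees_to_gr x = rees_to_gr y <->
  forall q, fm_prev M q (fp_val (x q) - fp_val (y q)).
Proof.
split=> [xy q|xy]; last by apply: dsumP => q; apply/gprojE/xy.
by apply/gprojE; apply: (congr1 (fun z : Gr M => z q) xy).
Qed.

Lemma rees_to_gr0 M : rees_to_gr (0 : Rees M) = 0.
Proof. by apply: dsumP => q; exact: gproj0. Qed.

Lemma fm_prev0 M q : fm_prev M q 0.
Proof. by case: q => // q; exact: fm_fil0. Qed.

Lemma fm_prevN M q x : fm_prev M q x -> fm_prev M q (- x).
Proof. by case: q => [->|q]; [exact: oppr0|exact: fm_filN]. Qed.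

Lemma fm_prevBC M q x y : fm_prev M q (x - y) -> fm_prev M q (y - x).
Proof. by rewrite -[y - x]opprB; exact: fm_prevN. Qed.

Lemma fm_prev_fil M q x : fm_prev M q x -> fm_fil M q x.
Proof. by case: q => [->|q]; [exact: fm_fil0|exact: fm_inc]. Qed.

(** The condition on 0 is what makes the componentwise choice finitely
    supported. *)
Lemma rees_choice M (R : nat -> M -> Prop) :
  (forall q, exists2 x, fm_fil M q x & R q x) ->
  (exists n, forall q, (n <= q)%N -> R q 0) ->
  exists x : Rees M, forall q, R q (fp_val (x q)).
Proof.
move=> hR [n hn].
have hR' q : {y : fpart M q | R q (fp_val y)}.
  by apply: cid; have [x xq Rx] := hR q; exists (FPart (asboolT xq)).
pose f q : fpart M q := if (n <= q)%N then 0 else sval (hR' q).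
have hf : exists m, forall q, (m <= q)%N -> f q = 0.
  by exists n => q nq; rewrite /f nq.
exists (Dsum hf) => q /=; rewrite /f; case: ifP => [/hn //|_].
exact: svalP (hR' q).
Qed.

(** A preimage is assembled from preimages of the components, so membership in
    the range is a condition on each degree separately. *)
Lemma rees_map_range X Y (h : filtHom X Y) (y : Rees Y) :
  range (rees_map h) y <-> forall q, (h @` fm_fil X q) (fp_val (y q)).
Proof.
split=> [[x _ <-] q|hy]; first by exists (fp_val (x q)) => //; exact: fpartP.
have [|x hx] := @rees_choice X (fun q x => h x = fp_val (y q)) hy.
  by have [n hn] := dsum_fin y; exists n => q /hn ->; exact: linear0.
by exists x => //; apply: reesP.
Qed.

Lemma gr_map_range X Y (h : filtHom X Y) (y : Rees Y) :
  range (gr_map h) (rees_to_gr y) <->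
  forall q, exists2 x, fm_fil X q x & fm_prev Y q (h x - fp_val (y q)).
Proof.
split=> [[x _]|hy].
  have [x' <-] := rees_to_gr_surj x; rewrite gr_map_to_gr => /rees_to_grE hx q.
  by exists (fp_val (x' q)); [exact: fpartP|exact: hx].
have [|x hx] :=
  @rees_choice X (fun q x => fm_prev Y q (h x - fp_val (y q))) hy.
  have [n hn] := dsum_fin y; exists n => q /hn -> /=.
  by rewrite linear0 subr0; exact: fm_prev0.
by exists (rees_to_gr x) => //; rewrite gr_map_to_gr; apply/rees_to_grE.
Qed.

Lemma rees_map_surj X Y (h : filtHom X Y) :
  strict_filtered h -> range h = setT -> range (rees_map h) = setT.
Proof.
move=> hs hT; apply/seteqP; split=> // y _; apply/rees_map_range => q.
by rewrite hs hT; split=> //; exact: fpartP.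
Qed.

Lemma gr_map_surj X Y (h : filtHom X Y) :
  strict_filtered h -> range h = setT -> range (gr_map h) = setT.
Proof.
move=> hs hT; apply/seteqP; split=> // y' _; have [y <-] := rees_to_gr_surj y'.
apply/gr_map_range => q.
have : (h @` fm_fil X q) (fp_val (y q)).
  by rewrite hs hT; split=> //; exact: fpartP.
by case=> x xq <-; exists x => //; rewrite subrr; exact: fm_prev0.
Qed.

Lemma rees_map_exact X Y Z (f : filtHom X Y) (g : filtHom Y Z) :
  strict_filtered f -> range f = [set y | g y = 0] ->
  range (rees_map f) = [set y | rees_map g y = 0].
Proof.
move=> fs fg; apply/seteqP; split=> y.
  move=> /rees_map_range hy; apply: reesP => q /=.
  have [x _ <-] := hy q.
  by have : range f (f x) by []; rewrite fg.
move=> gy; apply/rees_map_range => q; rewrite fs fg; split; last exact: fpartP.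
by move/(congr1 (fun z : Rees Z => fp_val (z q))): gy.
Qed.

(** Strictness one degree lower: this is what makes the associated graded
    functor exact, since a class killed by G(g) has a representative killed
    by g. *)
Lemma strict_prev Y Z (g : filtHom Y Z) q y : strict_filtered g ->
  fm_prev Z q (g y) -> exists2 y', fm_prev Y q y' & g y' = g y.
Proof.
case: q => [_ /= ->|q gs gy]; first by exists 0 => //; exact: linear0.
have : (range g `&` fm_fil Z q) (g y) by split=> //; exists y.
by rewrite -gs => -[y' yq yy]; exists y'.
Qed.

(** If y in F_q is sent into F_(q-1), strictness of g replaces y, modulo
    F_(q-1), by an element of Ker g, which strictness of f lifts to F_q. *)
Lemma gr_map_exact X Y Z (f : filtHom X Y) (g : filtHom Y Z) :
  strict_filtered f -> strict_filtered g -> range f = [set y | g y = 0] ->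
  range (gr_map f) = [set y | gr_map g y = 0].
Proof.
move=> fs gs fg; apply/seteqP; split=> y'; have [y <-] := rees_to_gr_surj y'.
  move=> /gr_map_range hy; rewrite /= gr_map_to_gr -rees_to_gr0.
  apply/rees_to_grE => q.
  have [x _ hx] := hy q; have /= := fh_prev g hx.
  have gf : g (f x) = 0 by have : range f (f x) by []; rewrite fg.
  by rewrite linearB gf; exact: fm_prevBC.
rewrite /= gr_map_to_gr -rees_to_gr0 => /rees_to_grE gy.
apply/gr_map_range => q; have := gy q; rewrite subr0 /=.
move=> /(strict_prev gs)[z zq gz].
have : (range f `&` fm_fil Y q) (fp_val (y q) - z).
  split; first by rewrite fg /= linearB gz subrr.
  by apply: fm_filD; [exact: fpartP|exact/fm_filN/fm_prev_fil].
rewrite -fs => -[x xq fx]; exists x => //.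
by rewrite fx addrAC subrr sub0r; exact: fm_prevN.
Qed.

(** * Generation, degree by degree *)

(** The filtration increases, so the sum of the F_p A with p + n <= q is its
    largest term F_(q-n) A. *)
Lemma sum_filE n q f : sum_fil FA n q f <->
  if (n <= q)%N then fa_fil FA (q - n) f else f = 0.
Proof.
have le_fil p p' g : (p <= p')%N -> fa_fil FA p g -> fa_fil FA p' g.
  by move/subnKC <-; elim: (p' - p)%N => [|k IH gp];
    rewrite ?addn0 // addnS; apply/fa_inc/IH.
split.
  case=> g [hg ->]; case: leqP => [nq|qn].
    have [h0 hD _] := fa_sub FA (q - n).
    elim/big_ind: _ => // p pq; apply: le_fil (hg p).
    by rewrite leq_subRL // addnC.
  rewrite big1 // => p pq; move: qn; rewrite ltnNge.
  by rewrite (leq_trans _ pq) // leq_addl.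
case: leqP => [nq fq|qn ->].
  exists (fun p => if p == (q - n)%N then f else 0); split=> [p|].
    by case: eqP => [->//|_]; case: (fa_sub FA p).
  have lq : (q - n < q.+1)%N by rewrite ltnS leq_subr.
  rewrite (bigD1 (Ordinal lq)) /= ?subnK // eqxx big1 ?addr0 // => p /andP[_].
  by rewrite -val_eqE /= => /negbTE ->.
by exists (fun=> 0); split=> [p|]; [case: (fa_sub FA p)|rewrite big1].
Qed.

Lemma sum_fil0 n q : sum_fil FA n q 0.
Proof. by apply/sum_filE; case: ifP => // _; case: (fa_sub FA (q - n)). Qed.

Lemma sum_filD n q f g :
  sum_fil FA n q f -> sum_fil FA n q g -> sum_fil FA n q (f + g).
Proof.
rewrite !sum_filE; case: ifP => _; last by move=> -> ->; rewrite addr0.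
by case: (fa_sub FA (q - n)) => _ + _; apply.
Qed.

Lemma sum_filN n q f : sum_fil FA n q f -> sum_fil FA n q (- f).
Proof.
rewrite !sum_filE; case: ifP => _; last by move=> ->; rewrite oppr0.
by case: (fa_sub FA (q - n)) => _ _ /(_ (-1) f); rewrite scaleN1r.
Qed.

Lemma sum_filS n q f : sum_fil FA n q f -> sum_fil FA n q.+1 f.
Proof.
rewrite !sum_filE; case: leqP => [nq|_ ->].
  by rewrite (leqW nq) subSn //; exact: fa_inc.
by case: ifP => // _; case: (fa_sub FA (q.+1 - n)).
Qed.

Lemma sum_fil_mul n p q f g :
  fa_fil FA p f -> sum_fil FA n q g -> sum_fil FA n (p + q) (f * g).
Proof.
rewrite !sum_filE => fp; case: leqP => [nq gq|_ ->].
  by rewrite (leq_trans nq (leq_addl _ _)) -addnBA //; exact: fa_mul.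
by rewrite mulr0; case: ifP => // _; case: (fa_sub FA (p + q - n)).
Qed.

Lemma sum_fil_mul2 n p q f g :
  sum_fil FA p q f -> sum_fil FA n p g -> sum_fil FA n q (f * g).
Proof.
move/sum_filE; case: leqP => [pq fq|_ -> _].
  by move=> /(sum_fil_mul fq); rewrite subnK.
by rewrite mul0r; exact: sum_fil0.
Qed.

Lemma sum_fil_scale M n q f (x : M) :
  sum_fil FA n q f -> fm_fil M n x -> fm_fil M q (f *: x).
Proof.
move/sum_filE; case: leqP => [nq fq|_ -> _].
  by move=> /(fm_mul fq); rewrite subnK.
by rewrite scale0r; exact: fm_fil0.
Qed.

(** The right-hand side of the defining identities of an F-basis, for chosen
    degrees b. *)
Definition fil_span (V : lmodType A) k (b : 'I_k -> nat) (v : 'I_k -> V)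
    (J : {set 'I_k}) (q : nat) : set V :=
  [set x | exists f : 'I_k -> A,
    (forall j, sum_fil FA (b j) q (f j)) /\ x = \sum_(j in J) f j *: v j].

Fact rees_elt_subproof M d (v : M) (vd : fm_fil M d v) q :
  fil_pred M q (if q == d then v else 0).
Proof. by apply/asboolP; case: eqP => [->//|_]; exact: fm_fil0. Qed.

Fact rees_elt_fin M d (v : M) (vd : fm_fil M d v) :
  exists n, forall q, (n <= q)%N -> FPart (rees_elt_subproof vd q) = 0.
Proof.
exists d.+1 => q dq; apply: val_inj => /=; case: eqP => // qd.
by rewrite qd ltnn in dq.
Qed.

Definition rees_elt M d (v : M) (vd : fm_fil M d v) : Rees M :=
  Dsum (rees_elt_fin vd).

Definition gr_elt M d (v : M) (vd : fm_fil M d v) : Gr M :=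
  rees_to_gr (rees_elt vd).

Lemma rees_elt_hom M d (v : M) (vd : fm_fil M d v) : Rees_hom d (rees_elt vd).
Proof. by move=> j jd; apply: val_inj => /=; case: eqP. Qed.

Lemma gr_elt_hom M d (v : M) (vd : fm_fil M d v) : Gr_hom d (gr_elt vd).
Proof. exact/rees_to_gr_hom/rees_elt_hom. Qed.

Lemma rees_map_elt X Y (h : filtHom X Y) d v (vd : fm_fil X d v)
  (hvd : fm_fil Y d (h v)) : rees_map h (rees_elt vd) = rees_elt hvd.
Proof.
by apply: reesP => q /=; case: eqP => // _; exact: linear0.
Qed.

Lemma gr_map_elt X Y (h : filtHom X Y) d v (vd : fm_fil X d v)
  (hvd : fm_fil Y d (h v)) : gr_map h (gr_elt vd) = gr_elt hvd.
Proof. by rewrite gr_map_to_gr (rees_map_elt vd hvd). Qed.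

(** The coefficient of v in degree q of c times v placed in degree d. *)
Definition shift_coef (c : rees_ring FA) d q : A :=
  if (d <= q)%N then fp_val (c (q - d)%N) else 0.

Lemma shift_coef_fil c d q : sum_fil FA d q (shift_coef c d q).
Proof.
apply/sum_filE; rewrite /shift_coef; case: (d <= q)%N => //.
exact: (@fpartP K A FA RA).
Qed.

Lemma rees_scale_elt M d (v : M) (vd : fm_fil M d v) (c : rees_ring FA) q :
  fp_val ((c *: rees_elt vd) q) = shift_coef c d q *: v.
Proof.
apply: (etrans (rees_scaleE c (rees_elt vd) q)); rewrite /shift_coef /=.
case: leqP => dq.
  have lq : (q - d < q.+1)%N by rewrite ltnS leq_subr.
  rewrite (bigD1 (Ordinal lq)) //= subKn // eqxx big1 ?addr0 // => i iq.
  case: eqP => [id|]; last by rewrite scaler0.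
  by case/negP: iq; apply/eqP/val_inj; rewrite /= -id subKn // -ltnS ltn_ord.
rewrite scale0r big1 // => i _; case: eqP => [id|]; last by rewrite scaler0.
by move: dq; rewrite -id ltnNge leq_subr.
Qed.

Lemma fp_val_sum M I (r : seq I) (Q : pred I) (F : I -> Rees M) q :
  fp_val ((\sum_(i <- r | Q i) F i) q) = \sum_(i <- r | Q i) fp_val (F i q).
Proof. by apply: (big_morph (fun x : Rees M => fp_val (x q))). Qed.

Lemma rees_sum_elt M k (b : 'I_k -> nat) (v : 'I_k -> M)
    (vb : forall j, fm_fil M (b j) (v j)) (J : {set 'I_k})
    (c : 'I_k -> rees_ring FA) q :
  fp_val ((\sum_(j in J) c j *: rees_elt (vb j)) q) =
  \sum_(j in J) shift_coef (c j) (b j) q *: v j.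
Proof.
by rewrite fp_val_sum; apply: eq_bigr => j _; rewrite rees_scale_elt.
Qed.

Lemma rees_to_gr_sum M k (J : {set 'I_k}) (c : 'I_k -> rees_ring FA)
    (y : 'I_k -> Rees M) :
  rees_to_gr (\sum_(j in J) c j *: y j) =
  \sum_(j in J) (rees_to_gr (c j) : gr_ring FA) *: rees_to_gr (y j) :> Gr M.
Proof.
rewrite (big_morph (@rees_to_gr K A FA M) (@rees_to_grD K A FA M) (id1 := 0)).
  by apply: eq_bigr => j _; exact: rees_to_gr_scale.
exact: rees_to_gr0.
Qed.

Lemma gr_coef_lift k (c : 'I_k -> gr_ring FA) :
  exists c' : 'I_k -> rees_ring FA, c = fun j => rees_to_gr (c' j).
Proof.
exists (fun j => sval (cid (rees_to_gr_surj (c j)))).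
by apply/funext => j; case: (cid _).
Qed.

(** Coefficients chosen independently in each degree q are the components, in
    degree q - b_j, of elements of the Rees ring; the bound on the support of y
    makes these elements finitely supported. *)
Lemma fil_span_coef (V : lmodType A) k (b : 'I_k -> nat) (v : 'I_k -> V)
    (J : {set 'I_k}) (y : nat -> V) :
  (forall q, fil_span b v J q (y q)) ->
  (exists n, forall q, (n <= q)%N -> y q = 0) ->
  exists c : 'I_k -> rees_ring FA,
    forall q, y q = \sum_(j in J) shift_coef (c j) (b j) q *: v j.
Proof.
move=> hy [n hn].
have [f hf] := choice hy.
pose g q j := if (n <= q)%N then 0 else f q j.
have gfil q j : sum_fil FA (b j) q (g q j).
  by rewrite /g; case: ifP => // _; [exact: sum_fil0|have [+ _] := hf q].
have hg j p : fm_fil RA p (g (p + b j)%N j).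
  by have /sum_filE := gfil (p + b j)%N j; rewrite leq_addl addnK.
have hfin j : exists m, forall p, (m <= p)%N -> FPart (asboolT (hg j p)) = 0.
  exists n => p np; apply: val_inj.
  by rewrite /= /g (leq_trans np (leq_addr _ _)).
exists (fun j => Dsum (hfin j)) => q.
transitivity (\sum_(j in J) g q j *: v j).
  rewrite /g; case: leqP => [/hn ->|_]; last by have [_ ->] := hf q.
  by rewrite big1 // => j _; rewrite scale0r.
apply: eq_bigr => j _; congr (_ *: _); rewrite /shift_coef /=.
have := gfil q j; rewrite sum_filE; case: leqP => [bq _|_ -> //].
by rewrite subnK.
Qed.

Section Generators.
Variables (M : filtMod FA) (k : nat) (b : 'I_k -> nat) (v : 'I_k -> M).
Variable (vb : forall j, fm_fil M (b j) (v j)).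

Lemma fil_span_fil J q x : fil_span b v J q x -> fm_fil M q x.
Proof.
case=> f [hf ->]; elim/big_ind: _ => [|x1 x2|j _].
- exact: fm_fil0.
- exact: fm_filD.
- exact: sum_fil_scale (vb j).
Qed.

Lemma fil_span_prev J q x : fil_span b v J q x -> fil_span b v J q.+1 x.
Proof. by case=> f [hf ->]; exists f; split=> // j; exact/sum_filS/hf. Qed.

Lemma fil_spanD J q x y :
  fil_span b v J q x -> fil_span b v J q y -> fil_span b v J q (x + y).
Proof.
case=> f [hf ->] [g [hg ->]]; exists (fun j => f j + g j); split=> [j|].
  by apply: sum_filD.
by rewrite -big_split; apply: eq_bigr => j _; rewrite scalerDl.
Qed.

Lemma rees_generated J (y : Rees M) :
  @generated_by (rees_ring FA) (Rees M) k (fun j => rees_elt (vb j)) J y <->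
  forall q, fil_span b v J q (fp_val (y q)).
Proof.
split=> [[c ->] q|hy].
  exists (fun j => shift_coef (c j) (b j) q); split; last exact: rees_sum_elt.
  by move=> j; exact: shift_coef_fil.
have [|c hc] := fil_span_coef hy.
  by have [n hn] := dsum_fin y; exists n => q /hn ->.
by exists c; apply: reesP => q; rewrite rees_sum_elt.
Qed.

Lemma gr_generated J (y : Rees M) :
  @generated_by (gr_ring FA) (Gr M) k (fun j => gr_elt (vb j)) J (rees_to_gr y)
  <-> forall q, exists2 x, fil_span b v J q x & fm_prev M q (fp_val (y q) - x).
Proof.
split=> [[c]|hy].
  have [c' ->] := gr_coef_lift c; rewrite -rees_to_gr_sum => /rees_to_grE hy q.
  exists (\sum_(j in J) shift_coef (c' j) (b j) q *: v j).
    exists (fun j => shift_coef (c' j) (b j) q); split=> // j.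
    exact: shift_coef_fil.
  by have := hy q; rewrite rees_sum_elt.
have [||x hx] := @rees_choice M
  (fun q x => fil_span b v J q x /\ fm_prev M q (fp_val (y q) - x)).
- by move=> q; have [x hx yx] := hy q; exists x => //; exact: fil_span_fil hx.
- have [n hn] := dsum_fin y; exists n => q /hn ->; split.
    exists (fun=> 0); split=> [j|]; first exact: sum_fil0.
    by rewrite big1 // => j _; rewrite scale0r.
  by rewrite subr0; exact: fm_prev0.
have [||c hc] := @fil_span_coef M k b v J (fun q => fp_val (x q)).
- by move=> q; have [] := hx q.
- by have [n hn] := dsum_fin x; exists n => q /hn ->.
exists (fun j => rees_to_gr (c j)); rewrite -rees_to_gr_sum; apply/rees_to_grE.
by move=> q; rewrite rees_sum_elt -hc; have [] := hx q.
Qed.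

End Generators.

(** * Irredundant F-bases as images of filtered free modules *)

Lemma fil_span_sub (V : lmodType A) k (b : 'I_k -> nat) (v : 'I_k -> V)
    (J J' : {set 'I_k}) q :
  J \subset J' -> fil_span b v J q `<=` fil_span b v J' q.
Proof.
move=> JJ' x [f [hf ->]]; exists (fun j => if j \in J then f j else 0).
split=> [j|]; first by case: ifP => // _; exact: sum_fil0.
rewrite [RHS](big_setID J) /= [X in _ + X]big1 => [|j].
  rewrite addr0 (finset.setIidPr JJ'); apply: eq_bigr => j jJ.
  by rewrite jJ.
by rewrite inE => /andP[/negbTE -> _]; rewrite scale0r.
Qed.

Section Cover.
Variables (L X : filtMod FA) (h : filtHom L X) (k : nat).
Variables (b : 'I_k -> nat) (e : 'I_k -> L).
Hypothesis eb : forall j, fm_fil L (b j) (e j).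
Hypothesis eL : forall q, fm_fil L q = fil_span b e [set: 'I_k]%SET q.
Hypothesis h_strict : strict_filtered h.
Hypothesis h_min : min_F_basis FA (fun q => h @` fm_fil L q) (fun j => h (e j)).

Let hb j : fm_fil X (b j) (h (e j)) := fh_fil h (eb j).

Lemma image_fil_span q :
  h @` fm_fil L q = fil_span b (fun j => h (e j)) [set: 'I_k]%SET q.
Proof.
rewrite eL; apply/seteqP; split=> x.
  case=> _ [f [hf ->]] <-; exists f; split=> //.
  by rewrite linear_sum; apply: eq_bigr => j _; rewrite linearZ.
case=> f [hf ->]; exists (\sum_(j in [set: 'I_k]%SET) f j *: e j).
  by exists f.
by rewrite linear_sum; apply: eq_bigr => j _; rewrite linearZ.
Qed.

(** Minimality refers to F-bases with arbitrary degrees; the degrees b of the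
    source serve for every subfamily. *)
Lemma min_F_basis_irredundant (J : {set 'I_k}) :
  J \proper [set: 'I_k]%SET ->
  ~ (forall q, h @` fm_fil L q `<=` fil_span b (fun j => h (e j)) J q).
Proof.
move=> Jp hJ; have [[v0 _] /(_ J Jp)] := h_min; apply; split=> [j _|].
  by apply: v0; rewrite inE.
exists b => q; apply/seteqP; split=> [x /hJ //|x xJ].
by rewrite image_fil_span; apply: fil_span_sub xJ; exact: finset.subsetT.
Qed.

Lemma rees_min_generating : @min_hom_generating (rees_ring FA) (Rees X) k
  (fun j => rees_map h (rees_elt (eb j))) (@Rees_hom K A FA X)
  (range (rees_map h)).
Proof.
split.
- by move=> j; exists (b j); apply/rees_map_hom/rees_elt_hom.
- under eq_fun do rewrite (rees_map_elt _ (hb _)).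
  by apply/seteqP; split=> y;
    rewrite rees_generated rees_map_range => hy q;
    move: (hy q); rewrite image_fil_span.
- move=> J Jp; under eq_fun do rewrite (rees_map_elt _ (hb _)).
  move=> JE; apply: (min_F_basis_irredundant Jp) => q x xq.
  have xX : fm_fil X q x by move: xq; rewrite h_strict => -[].
  have : range (rees_map h) (rees_elt xX).
    apply/rees_map_range => p /=; case: eqP => [-> //|_].
    by exists 0; [exact: fm_fil0|exact: linear0].
  by rewrite -JE => /rees_generated /(_ q) /=; rewrite eqxx.
Qed.

(** A generating subfamily of the graded range spans each h(F_q L) only modulo
    F_(q-1); strictness puts the error into h(F_(q-1) L), and induction on q
    removes it. *)
Lemma gr_min_generating : @min_hom_generating (gr_ring FA) (Gr X) k
  (fun j => gr_map h (gr_elt (eb j))) (@Gr_hom K A FA X)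
  (range (gr_map h)).
Proof.
split.
- by move=> j; exists (b j); apply/gr_map_hom/gr_elt_hom.
- under eq_fun do rewrite (gr_map_elt _ (hb _)).
  apply/seteqP; split=> y'; have [y <-] := rees_to_gr_surj y';
    rewrite gr_generated gr_map_range => hy q; have [x] := hy q.
    by rewrite -image_fil_span => -[z zq <-] /fm_prevBC xy; exists z.
  move=> xq /fm_prevBC xy; exists (h x) => //.
  by rewrite -image_fil_span; exists x.
- move=> J Jp; under eq_fun do rewrite (gr_map_elt _ (hb _)).
  move=> JE; apply: (min_F_basis_irredundant Jp).
  have step q x : (h @` fm_fil L q) x -> exists2 z,
      fil_span b (fun j => h (e j)) J q z & fm_prev X q (x - z).
    move=> xq; have xX : fm_fil X q x by move: xq; rewrite h_strict => -[].
    have : range (gr_map h) (gr_elt xX).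
      apply/gr_map_range => p /=; case: eqP => [->|_].
        case: xq => z zq <-; exists z => //.
        by rewrite subrr; exact: fm_prev0.
      exists 0; first exact: fm_fil0.
      by rewrite linear0 subrr; exact: fm_prev0.
    rewrite -JE => /gr_generated /(_ q) [z zq] /=.
    by rewrite eqxx => xz; exists z.
  elim=> [|q IH] x xq; have [z zq xz] := step _ _ xq.
    by move/eqP: xz; rewrite subr_eq0 => /eqP ->.
  (* The error x - z has lower degree and lies in the range of h. *)
  rewrite -[x](subrK z); apply: fil_spanD => //.
  apply/fil_span_prev/IH; rewrite h_strict; split=> //.
  have : range h z.
    have := fil_span_sub (finset.subsetT J) zq.
    by rewrite -image_fil_span => -[z' _ <-].
  by case: xq => x' _ <- [z' _ <-]; exists (x' - z') => //; rewrite linearB.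
Qed.

Hypothesis F0_field :
  forall f, fa_fil FA 0 f -> f <> 0 -> exists2 g, fa_fil FA 0 g & g * f = 1.

(** A coefficient at e_l with b_l = q lies in F_0 A; if it were nonzero it
    could be inverted there, and h (e l) would be a combination, of the right
    degrees, of the other h (e j). *)
Lemma min_F_basis_relation q (f : 'I_k -> A) :
  (forall j, sum_fil FA (b j) q (f j)) -> \sum_j f j *: h (e j) = 0 ->
  forall l, b l = q -> f l = 0.
Proof.
move=> hf f0 l bl; apply: contrapT => fl0.
have := hf l; rewrite sum_filE bl leqnn subnn => /F0_field/(_ fl0)[g g0 gf].
apply: (@min_F_basis_irredundant ([set: 'I_k] :\ l)%SET).
  by rewrite properD1 // inE.
move=> p _ [x xp <-].
have := image_fil_span p => /seteqP[+ _] => /(_ (h x)).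
case; first by exists x.
(* Subtract c_l g times the relation: the coefficient at l cancels. *)
move=> c [hc ->]; exists (fun j => c j - c l * (g * f j)); split=> [j|].
  apply/sum_filD/sum_filN => //; apply: sum_fil_mul2 (hc l) _.
  by rewrite bl; apply: (sum_fil_mul (p := 0)).
have -> : \sum_(j in [set: 'I_k]%SET) c j *: h (e j) =
    \sum_j (c j - c l * (g * f j)) *: h (e j).
  under [RHS]eq_bigr do rewrite scalerBl -!scalerA.
  rewrite sumrB -!scaler_sumr f0 !scaler0 subr0.
  by apply: eq_bigl => j; rewrite inE.
rewrite (bigD1 l) //= gf mulr1 subrr scale0r add0r.
by apply: eq_bigl => j; rewrite !inE andbT.
Qed.

End Cover.

End Filtered.

(** * Filtered free modules *)

Section Free.
Variables (K : fieldType) (A : algType K) (P : wfSolvPolyAlg A).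
Notation FA := (wf_filtAlg P).
Notation RA := (regMod FA).

(** Positive weights leave 1 as the only monomial of degree 0. *)
Lemma wf_fil0_scalar f : fa_fil FA 0 f -> exists c : K, f = c%:A.
Proof.
case=> r [c [v [hv ->]]]; exists (\sum_i c i).
rewrite scaler_suml; apply: eq_bigr => i _; congr (_ *: _).
have [al [+ ->]] := hv i; rewrite leqn0 /wdeg sum_nat_eq0 => /forallP al0.
apply: big1 => j _; have := al0 j.
by rewrite muln_eq0 -leqn0 leqNgt wf_wt_gt0 /= => /eqP ->.
Qed.

Lemma wf_fil0_inv f : fa_fil FA 0 f -> f <> 0 ->
  exists2 g, fa_fil FA 0 g & g * f = 1.
Proof.
move=> /wf_fil0_scalar[c ->] c0.
have {}c0 : c != 0 by apply/eqP => c00; apply: c0; rewrite c00 scale0r.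
exists (c^-1)%:A; last by rewrite mulr_algl scalerA mulVf // scale1r.
have [_ _ h] := fa_sub FA 0; apply: h; exact: fa_one.
Qed.

Lemma sum_inT (V : nmodType) k (F : 'I_k -> V) :
  \sum_j F j = \sum_(j in [set: 'I_k]%SET) F j.
Proof. by apply: eq_bigl => j; rewrite inE. Qed.

Section FreeModule.
Variable D : freeData.
Notation L := (freeMod P D).
Notation b := (@fd_deg D).
Notation e := (@std_basis K A D).

Lemma free_coords (x : 'rV[A]_(fd_rank D)) : x = \sum_j x 0 j *: e j.
Proof. exact: row_sum_delta. Qed.

Lemma coord_sum (f : 'I_(fd_rank D) -> A) l : (\sum_j f j *: e j) 0 l = f l.
Proof.
rewrite summxE (bigD1 l) //= big1 => [|j jl].
  by rewrite addr0 /std_basis !mxE !eqxx mulr1.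
by rewrite /std_basis !mxE eq_sym (negbTE jl) andbF mulr0.
Qed.

Lemma std_basis_fil j : fm_fil L (b j) (e j).
Proof.
rewrite -[e j]scale1r; apply: (free_coef (P := P) (p := 0)) => //.
exact: wf_one.
Qed.

Lemma free_filE q (x : 'rV[A]_(fd_rank D)) :
  fm_fil L q x <-> forall j, sum_fil FA (b j) q (x 0 j).
Proof.
split=> [|hx]; last first.
  rewrite (free_coords x).
  elim/(@big_ind L): _ => [|y z|j _].
  - exact: (@fm_fil0 K A FA L).
  - exact: (@fm_filD K A FA L).
  - by apply: (@sum_fil_scale K A FA L _ _ _ (e j)) (std_basis_fil j).
move=> hx j; move: x hx; apply: Kspan_ind.
  split=> [|x y|c x hx].
  - by rewrite mxE; exact: sum_fil0.
  - by rewrite mxE; exact: sum_filD.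
  - rewrite mxE; apply: (sum_fil_mul (p := 0)) => //.
    have [_ _ h] := fa_sub FA 0; apply: h; exact: fa_one.
move=> _ [al [i [hq ->]]]; rewrite !mxE eqxx /=; case: eqP => [ij|_].
  rewrite mulr1; apply/sum_filE; rewrite ij (leq_trans _ hq) ?leq_addl //.
  by apply: wf_mono; rewrite leq_subRL ?(leq_trans _ hq) ?leq_addl // addnC.
by rewrite mulr0; exact: sum_fil0.
Qed.

Lemma free_fil_span q :
  fm_fil L q = fil_span FA b (e : _ -> L) [set: 'I_(fd_rank D)]%SET q.
Proof.
apply/seteqP; split=> x.
  move=> /free_filE hx; exists (fun j => (x : 'rV[A]_(fd_rank D)) 0 j).
  split=> //; rewrite {1}(free_coords x).
  by apply: eq_bigl => j; rewrite inE.
exact: (fil_span_fil (M := L) std_basis_fil).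
Qed.

(** The coordinatewise description of F_(q-1), which shows that relations in the
    graded module come from coefficients that vanish in G(A). *)
Lemma free_prev_coord q (x : 'rV[A]_(fd_rank D)) j :
  fm_prev L q x -> (b j <= q)%N -> fm_prev RA (q - b j) (x 0 j).
Proof.
case: q => [/= -> _|q]; first by rewrite mxE.
move=> /free_filE /(_ j) /sum_filE xj _; move: xj.
case: leqP => [bq|_ ->]; first by rewrite subSn.
by case: (q.+1 - b j)%N => //= n; exact: (@fm_fil0 K A FA RA).
Qed.

Lemma rees_free_basis :
  @free_basis (rees_ring FA) (Rees L) _ (fun j => rees_elt (std_basis_fil j)).
Proof.
split.
  apply/seteqP; split=> // y _; apply/rees_generated => q.
  by rewrite -free_fil_span; exact: fpartP.
move=> c c0 j; apply: reesP => p.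
have := congr1 (fun x : Rees L => fp_val (x (p + b j)%N)) c0.
rewrite sum_inT (rees_sum_elt std_basis_fil) -sum_inT.
move=> /(congr1 (fun x : L => x 0 j)).
by rewrite coord_sum mxE /shift_coef leq_addl addnK.
Qed.

Lemma gr_free_basis :
  @free_basis (gr_ring FA) (Gr L) _ (fun j => gr_elt (std_basis_fil j)).
Proof.
split.
  apply/seteqP; split=> // y' _; have [y <-] := rees_to_gr_surj y'.
  apply/gr_generated => q; exists (fp_val (y q)).
    by rewrite -free_fil_span; exact: fpartP.
  by rewrite subrr; exact: (@fm_prev0 K A FA L).
move=> c; have [c' ->] := gr_coef_lift c => c0 j.
rewrite -(rees_to_gr0 RA); apply/rees_to_grE => p.
move: c0; rewrite sum_inT -rees_to_gr_sum -rees_to_gr0.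
move=> /rees_to_grE/(_ (p + b j)%N).
rewrite subr0 rees_sum_elt -sum_inT => /free_prev_coord /(_ (leq_addl _ _)).
by rewrite coord_sum /shift_coef leq_addl addnK subr0.
Qed.

End FreeModule.
(** * Uniqueness of minimal covers *)

Section FreeMap.
Variables (D : freeData) (M : filtMod FA) (y : 'I_(fd_rank D) -> M).

Definition free_map (x : freeMod P D) : M :=
  \sum_j (x : 'rV[A]_(fd_rank D)) 0 j *: y j.

Fact free_map_linear : linear free_map.
Proof.
move=> a u v; rewrite /free_map scaler_sumr -big_split; apply: eq_bigr => j _.
by rewrite !mxE scalerDl scalerA.
Qed.
HB.instance Definition _ :=
  GRing.isLinear.Build A (freeMod P D) M _ free_map free_map_linear.

End FreeMap.

Lemma free_lift D (M : filtMod FA) (X : lmodType A)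
    (g : {linear M -> X}) (h : {linear freeMod P D -> X}) :
  (forall q, h @` fm_fil (freeMod P D) q `<=` g @` fm_fil M q) ->
  exists chi : {linear freeMod P D -> M},
    (forall q x, fm_fil (freeMod P D) q x -> fm_fil M q (chi x)) /\
    (forall x, g (chi x) = h x).
Proof.
move=> hg.
have /choice[y hy] j : exists z, fm_fil M (fd_deg j) z /\
    g z = h (@std_basis K A D j).
  have [|z zb gz] := hg (fd_deg j) (h (@std_basis K A D j)); last by exists z.
  by exists (@std_basis K A D j) => //; exact: std_basis_fil.
exists (free_map y); split=> [q x /free_filE hx|x].
  rewrite /= /free_map; elim/big_ind: _ => [|u v|j _].
  - exact: fm_fil0.
  - exact: fm_filD.
  - by apply: sum_fil_scale (hx j) _; have [] := hy j.
rewrite /= /free_map linear_sum [in RHS](free_coords x) (linear_sum h).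
apply: eq_bigr => j _; rewrite linearZ; have [_ ->] := hy j.
by rewrite (linearZ_LR h).
Qed.

(** The form in which minimality survives composition with an injective map: no
    relation of degree q involves a basis element of degree q. *)
Definition minimal_relations D (X : lmodType A)
    (h : {linear freeMod P D -> X}) : Prop :=
  forall q (x : freeMod P D), fm_fil (freeMod P D) q x -> h x = 0 ->
  forall l, fd_deg l = q -> (x : 'rV[A]_(fd_rank D)) 0 l = 0.

(** A filtered endomorphism theta over h differs from the identity by a map with
    values in the relations of h. *)
Section Endomorphism.
Variables (D : freeData) (X : lmodType A) (h : {linear freeMod P D -> X}).
Hypothesis h_min : minimal_relations h.
Variable theta : {linear freeMod P D -> freeMod P D}.
Hypothesis theta_fil :
  forall q x, fm_fil (freeMod P D) q x -> fm_fil (freeMod P D) q (theta x).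
Hypothesis theta_h : forall x, h (theta x) = h x.
Notation L := (freeMod P D).

Definition low_coords c (x : 'rV[A]_(fd_rank D)) : Prop :=
  forall l, (c <= fd_deg l)%N -> x 0 l = 0.

(** The image of e_j under theta - id is a relation of degree b_j, so it only
    involves basis elements of degree less than b_j: theta - id is strictly
    triangular. *)
Lemma theta_low c (x : L) : low_coords c.+1 x -> low_coords c (theta x - x).
Proof.
move=> xc l cl; pose n j : L := theta (@std_basis K A D j) - @std_basis K A D j.
have -> : theta x - x = \sum_j (x : 'rV[A]_(fd_rank D)) 0 j *: n j.
  rewrite {1 2}(free_coords x) (linear_sum theta) -sumrB.
  by apply: eq_bigr => j _; rewrite (linearZ_LR theta) -scalerBr.
rewrite summxE big1 // => j _; rewrite mxE.
have [jc|cj] := leqP (fd_deg j) c; last by rewrite (xc _ cj) mul0r.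
have nb : fm_fil L (fd_deg j) (n j).
  apply: fm_filD; first exact/theta_fil/std_basis_fil.
  exact/fm_filN/std_basis_fil.
have hn : h (n j) = 0 by rewrite linearB theta_h subrr.
have [jl|lj] := ltnP (fd_deg j) (fd_deg l).
  have /free_filE/(_ l)/sum_filE := nb.
  by rewrite leqNgt jl /= => ->; rewrite mulr0.
rewrite (h_min nb hn) ?mulr0 //; apply/eqP; rewrite eqn_leq lj.
exact: leq_trans jc cl.
Qed.

Lemma theta_inj_low c (x : L) : low_coords c x -> theta x = 0 -> x = 0.
Proof.
elim: c x => [|c IH] x xc tx.
  by apply/rowP => l; rewrite xc // mxE.
apply: IH => //; have := theta_low xc; rewrite tx sub0r => xc' l cl.
by apply/eqP; rewrite -oppr_eq0; have := xc' l cl; rewrite mxE => ->.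
Qed.

Lemma theta_surj_low c q (x : L) : low_coords c x -> fm_fil L q x ->
  exists2 y, fm_fil L q y & theta y = x.
Proof.
elim: c x => [|c IH] x xc xq.
  exists 0; first exact: fm_fil0.
  by rewrite linear0; apply/rowP => l; rewrite xc // mxE.
(* If y is a preimage of theta x - x, then x - y is one of x. *)
have [||y yq ty] := IH (theta x - x).
- exact: theta_low.
- by apply: fm_filD; [exact: theta_fil|exact: fm_filN].
exists (x - y); first by apply: fm_filD => //; exact: fm_filN.
by rewrite linearB ty opprB addrC subrK.
Qed.

Lemma low_coords_max x : low_coords (\max_j @fd_deg D j).+1 x.
Proof.
by move=> l; rewrite ltnNge (leq_bigmax (F := @fd_deg D)).
Qed.

Lemma theta_inj : injective theta.
Proof.
move=> x y txy; apply/eqP; rewrite -subr_eq0; apply/eqP.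
by apply: (theta_inj_low (low_coords_max _)); rewrite linearB txy subrr.
Qed.

Lemma theta_surj q (x : L) :
  fm_fil L q x -> exists2 y, fm_fil L q y & theta y = x.
Proof. exact/theta_surj_low/low_coords_max. Qed.

End Endomorphism.

Lemma minimal_cover_unique D D' (X : lmodType A)
    (h : {linear freeMod P D -> X}) (h' : {linear freeMod P D' -> X}) :
  minimal_relations h -> minimal_relations h' ->
  (forall q, h @` fm_fil (freeMod P D) q = h' @` fm_fil (freeMod P D') q) ->
  exists chi : {linear freeMod P D -> freeMod P D'},
    strict_filtered_iso chi /\ forall x, h' (chi x) = h x.
Proof.
move=> hm hm' hh'.
have [|chi [chi_fil chi_h]] := @free_lift D (freeMod P D') X h' h.
  by move=> q; rewrite hh'.
have [|psi [psi_fil psi_h]] := @free_lift D' (freeMod P D) X h h'.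
  by move=> q; rewrite hh'.
(* psi chi and chi psi lie over h and h', hence are bijective on each F_q. *)
have inj : injective (psi \o chi).
  apply: (theta_inj hm); first by move=> q x xq; apply/psi_fil/chi_fil.
  by move=> x; rewrite /= psi_h.
have surj q y : fm_fil (freeMod P D') q y ->
    exists2 x, fm_fil (freeMod P D) q x & chi x = y.
  have tf q0 x : fm_fil (freeMod P D') q0 x ->
      fm_fil (freeMod P D') q0 ((chi \o psi) x).
    by move=> xq; apply/chi_fil/psi_fil.
  have th x : h' ((chi \o psi) x) = h' x by rewrite /= chi_h.
  move=> /(theta_surj hm' tf th)[z zq zy].
  by exists (psi z); first exact: psi_fil.
exists chi; split=> //; split=> [|q].
  have /choice[g gK] y : exists x, chi x = y.
    by have [q yq] := fm_exh y; have [x _ xy] := surj q y yq; exists x.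
  by exists g => // x; apply: inj; rewrite /= gK.
apply/seteqP; split=> [_ [x xq <-]|y /surj[x xq xy]]; first exact: chi_fil.
by exists x.
Qed.

End Free.

Lemma quotProj_strict (K : fieldType) (A : algType K) (FA : filtAlg A)
    (M : filtMod FA) (N : submodClosed M) : strict_filtered (quotProj N).
Proof.
move=> q; apply/seteqP; split=> [y [x xq <-]|y [_ //]].
by split; [exists x|exists x].
Qed.

Lemma quotProj_surj (K : fieldType) (A : algType K) (FA : filtAlg A)
    (M : filtMod FA) (N : submodClosed M) : range (quotProj N) = setT.
Proof.
by apply/seteqP; split=> // y _; elim/qmod_ind: y => x; exists x.
Qed.


(** * Minimal filtered free resolutions *)

Section Resolution.
Variables (K : fieldType) (A : algType K) (P : wfSolvPolyAlg A).
Notation FA := (wf_filtAlg P).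

Lemma min_F_basis_minimal_relations D (X : filtMod FA)
    (h : filtHom (freeMod P D) X) :
  strict_filtered h ->
  min_F_basis FA (fun q => h @` fm_fil (freeMod P D) q)
    (fun j => h (@std_basis K A D j)) ->
  minimal_relations h.
Proof.
move=> hs hm q x /free_filE xq hx.
apply: (min_F_basis_relation (@free_fil_span _ _ P D) hm
  (@wf_fil0_inv _ _ P) xq).
rewrite -[RHS]hx [in RHS](free_coords x) (linear_sum h).
by apply: eq_bigr => j _; rewrite (linearZ_LR h).
Qed.

Variables (D0 : freeData) (N : submodClosed (freeMod P D0)).

Section OneResolution.
Variables (D : nat -> freeData).
Notation L := (res_mod P D0 D).
Variable phi : forall i, filtHom (L i.+1) (L i).
Hypothesis hphi : min_filt_free_resolution N phi.
Notation ker := (@res_ker A (quotMod N) L (quotProj N) phi).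

Lemma res_range i : range (phi i) = ker i.
Proof. by have [_ [_ ->]] := hphi. Qed.

Lemma res_strict i : strict_filtered (phi i).
Proof. by have [_ _ + _] := hphi; apply. Qed.

Lemma res_image i q : phi i @` fm_fil (L i.+1) q = ker i `&` fm_fil (L i) q.
Proof. by rewrite res_strict res_range. Qed.

Lemma res_min0 : min_F_basis FA (fun q => quotProj N @` fm_fil (L 0%N) q)
  (fun j => quotProj N (@std_basis K A D0 j)).
Proof. by have [] := hphi. Qed.

Lemma res_minS i : min_F_basis FA (fun q => phi i @` fm_fil (L i.+1) q)
  (fun j => phi i (@std_basis K A (D i) j)).
Proof.
have [_ _ _ /(_ i)] := hphi.
by rewrite /min_standard_basis (funext (fun q => res_image i q)).
Qed.

Lemma rees_resolution :
  @min_graded_free_resolution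
    (rees_ring FA) (@Rees_hom K A _ (regMod FA))
    (Rees (quotMod N)) (@Rees_hom K A _ (quotMod N))
    (fun i => Rees (L i)) (fun i => @Rees_hom K A _ (L i))
    (rees_map (quotProj N)) (fun i => rees_map (phi i)).
Proof.
split.
- split; [exact: rees_graded_ring|exact: rees_graded_module|].
  by move=> i; exact: rees_graded_module.
- by split=> [q x|i q x]; exact: rees_map_hom.
- split=> [|[|i]].
  + exact: (rees_map_surj (@quotProj_strict _ _ _ _ N) (quotProj_surj N)).
  + exact: (rees_map_exact (g := quotProj N) (@res_strict 0) (res_range 0)).
  + exact: (rees_map_exact (g := phi i) (@res_strict i.+1) (res_range i.+1)).
split=> [|i].
  exists _, (fun j => rees_elt (std_basis_fil P (D := D0) j)); split.
  - exact: rees_free_basis.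
  - by move=> j; exists (fd_deg j); exact: rees_elt_hom.
  - exact: (rees_min_generating (std_basis_fil P (D := D0))
      (@free_fil_span _ _ P D0) (@quotProj_strict _ _ _ _ N) res_min0).
exists _, (fun j => rees_elt (std_basis_fil P (D := D i) j)); split.
- exact: rees_free_basis.
- by move=> j; exists (fd_deg j); exact: rees_elt_hom.
- exact: (rees_min_generating (std_basis_fil P (D := D i))
    (@free_fil_span _ _ P (D i)) (@res_strict i) (res_minS i)).
Qed.

Lemma gr_resolution :
  @min_graded_free_resolution
    (gr_ring FA) (@Gr_hom K A _ (regMod FA))
    (Gr (quotMod N)) (@Gr_hom K A _ (quotMod N))
    (fun i => Gr (L i)) (fun i => @Gr_hom K A _ (L i))
    (gr_map (quotProj N)) (fun i => gr_map (phi i)).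
Proof.
split.
- split; [exact: gr_graded_ring|exact: gr_graded_module|].
  by move=> i; exact: gr_graded_module.
- by split=> [q x|i q x]; exact: gr_map_hom.
- split=> [|[|i]].
  + exact: (gr_map_surj (@quotProj_strict _ _ _ _ N) (quotProj_surj N)).
  + exact: (gr_map_exact (g := quotProj N) (@res_strict 0)
      (@quotProj_strict _ _ _ _ N) (res_range 0)).
  + exact: (gr_map_exact (g := phi i) (@res_strict i.+1)
      (@res_strict i) (res_range i.+1)).
split=> [|i].
  exists _, (fun j => gr_elt (std_basis_fil P (D := D0) j)); split.
  - exact: gr_free_basis.
  - by move=> j; exists (fd_deg j); exact: gr_elt_hom.
  - exact: (gr_min_generating (std_basis_fil P (D := D0))
      (@free_fil_span _ _ P D0) (@quotProj_strict _ _ _ _ N) res_min0).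
exists _, (fun j => gr_elt (std_basis_fil P (D := D i) j)); split.
- exact: gr_free_basis.
- by move=> j; exists (fd_deg j); exact: gr_elt_hom.
- exact: (gr_min_generating (std_basis_fil P (D := D i))
    (@free_fil_span _ _ P (D i)) (@res_strict i) (res_minS i)).
Qed.

End OneResolution.

(** The images of the basis of the bottom free module generate M. *)
Lemma resolution_finitely_generated (R : pzRingType) (R_ : nat -> set R)
    (M : lmodType R) (M_ : nat -> set M) (L : nat -> lmodType R)
    (L_ : forall i, nat -> set (L i)) (phi0 : {linear L 0%N -> M})
    (phi : forall i, {linear L i.+1 -> L i}) :
  min_graded_free_resolution R_ M_ L_ phi0 phi -> finitely_generated M.
Proof.
case=> _ _ [phi0T _] [[k [e [_ _ [_ eM _]]]] _].
by exists k, (fun j => phi0 (e j)); rewrite eM.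
Qed.

Section Uniqueness.
Variables (D D' : nat -> freeData).
Notation L := (res_mod P D0 D).
Notation L' := (res_mod P D0 D').
Variable phi : forall i, filtHom (L i.+1) (L i).
Variable phi' : forall i, filtHom (L' i.+1) (L' i).
Hypothesis hphi : min_filt_free_resolution N phi.
Hypothesis hphi' : min_filt_free_resolution N phi'.
Notation ker := (@res_ker A (quotMod N) L (quotProj N) phi).
Notation ker' := (@res_ker A (quotMod N) L' (quotProj N) phi').

(** The induction hypothesis for the construction of chi_i: compatibility with
    the kernels is what makes the next covers have the same images. *)
Definition cycle_iso i (chi : {linear L i -> L' i}) : Prop :=
  strict_filtered_iso chi /\ forall x, ker i x <-> ker' i (chi x).

Lemma cycle_iso_image i (chi : {linear L i -> L' i}) q : cycle_iso chi ->
  (chi \o phi i) @` fm_fil (L i.+1) q = phi' i @` fm_fil (L' i.+1) q.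
Proof.
move=> [[_ chi_fil] chi_ker]; rewrite (res_image hphi').
rewrite -[LHS]image_comp (res_image hphi) -chi_fil.
apply/seteqP; split=> [_ [x [xk xq] <-]|y [yk [x xq xy]]].
  by split; [apply/chi_ker|exists x].
by exists x => //; split=> //; apply/chi_ker; rewrite xy.
Qed.

Lemma cycle_iso_step i (chi : {linear L i -> L' i}) : cycle_iso chi ->
  exists chi' : {linear L i.+1 -> L' i.+1},
    cycle_iso chi' /\ forall x, chi (phi i x) = phi' i (chi' x).
Proof.
move=> chiP; have [[/bij_inj chi_inj _] _] := chiP.
have hm :=
  min_F_basis_minimal_relations (@res_strict _ _ hphi i) (res_minS hphi i).
have hm' :=
  min_F_basis_minimal_relations (@res_strict _ _ hphi' i) (res_minS hphi' i).
have [|chi' [chi'_iso chi'_phi]] := @minimal_cover_unique K A P (D i) (D' i)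
    (L' i) (chi \o phi i) (phi' i) _ hm' (fun q => cycle_iso_image q chiP).
  move=> q x xq /=; rewrite -[RHS](linear0 chi) => /chi_inj.
  exact: hm.
exists chi'; split; last by move=> x; rewrite chi'_phi.
split=> // x; rewrite /= chi'_phi /=; split=> [->|]; first exact: linear0.
by rewrite -[RHS](linear0 chi) => /chi_inj.
Qed.

Lemma resolution_unique : exists chi : forall i, {linear L i -> L' i},
  [/\ forall x, chi 0%N x = x,
      forall i, strict_filtered_iso (chi i)
    & forall i x, chi i (phi i x) = phi' i (chi i.+1 x)].
Proof.
have chi0 : cycle_iso (i := 0) (idfun : {linear L 0%N -> L' 0%N}).
  split=> //; split; first by exists id.
  by move=> q; rewrite image_id.
pose T i := {chi : {linear L i -> L' i} | cycle_iso chi}.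
pose step i (c : T i) := cid (cycle_iso_step (svalP c)).
pose s := fix s i : T i := match i with
  | 0%N => exist _ _ chi0
  | j.+1 => exist _ (sval (step j (s j))) (proj1 (svalP (step j (s j))))
  end.
exists (fun i => sval (s i)); split=> // i; first by have [] := svalP (s i).
by move=> x; have [_ ->] := svalP (step i (s i)).
Qed.

End Uniqueness.
End Resolution.

Theorem theorem6p3 (K : fieldType) (A : algType K) (P : wfSolvPolyAlg A)
    (m : nat) (b : 'I_m -> nat)
    (N : submodClosed (freeMod P (FreeData b)))
    (D : nat -> freeData)
    (phi : forall i, filtHom (res_mod P (FreeData b) D i.+1)
                             (res_mod P (FreeData b) D i))
    (hphi : min_filt_free_resolution N phi) :
  [/\ @finitely_generated (gr_ring (wf_filtAlg P)) (Gr (quotMod N)) /\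
      @min_graded_free_resolution
        (gr_ring (wf_filtAlg P)) (@Gr_hom K A _ (regMod (wf_filtAlg P)))
        (Gr (quotMod N)) (@Gr_hom K A _ (quotMod N))
        (fun i => Gr (res_mod P (FreeData b) D i))
        (fun i => @Gr_hom K A _ (res_mod P (FreeData b) D i))
        (gr_map (quotProj N)) (fun i => gr_map (phi i)),
      @finitely_generated (rees_ring (wf_filtAlg P)) (Rees (quotMod N)) /\
      @min_graded_free_resolution
        (rees_ring (wf_filtAlg P)) (@Rees_hom K A _ (regMod (wf_filtAlg P)))
        (Rees (quotMod N)) (@Rees_hom K A _ (quotMod N))
        (fun i => Rees (res_mod P (FreeData b) D i))
        (fun i => @Rees_hom K A _ (res_mod P (FreeData b) D i))
        (rees_map (quotProj N)) (fun i => rees_map (phi i))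
    & forall (D' : nat -> freeData)
        (phi' : forall i, filtHom (res_mod P (FreeData b) D' i.+1)
                                  (res_mod P (FreeData b) D' i)),
      min_filt_free_resolution N phi' ->
      exists chi : forall i, {linear res_mod P (FreeData b) D i ->
                                     res_mod P (FreeData b) D' i},
        [/\ forall x, chi 0%N x = x,
            forall i, strict_filtered_iso (chi i)
          & forall i x, chi i (phi i x) = phi' i (chi i.+1 x)]].
Proof.
split.
- have res := gr_resolution hphi.
  by split=> //; exact: resolution_finitely_generated res.
- have res := rees_resolution hphi.
  by split=> //; exact: resolution_finitely_generated res.
- by move=> D' phi' hphi'; exact: resolution_unique hphi hphi'.
Qed.
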